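(* Let $d\ge 1$, $s>0$, let $\omega$ be a measurable subset of $\mathbb{R}^d$ and $T>0$. If the fractional free Schrödinger equation $$\left\lbrace \begin{array}{ll} (\partial_t +i(-\Delta_x)^s)f(t,x)=u(t,x)\mathbf{1}_{\omega}(x), & x \in \mathbb{R}^d,\ t>0,\\ f|_{t=0}=f_0 \in L^2(\mathbb{R}^d),& \end{array}\right.$$ is exactly controllable from $\omega$ in time $T$, then $\omega$ is a thick set.
   Context: $|E|$ denotes the Lebesgue measure of a measurable set $E$, and $\mathbf{1}_\omega$ the indicator function of $\omega$. Thick set: a measurable set $\omega\subset\mathbb{R}^d$ is thick if there exist a cube $K\subset\mathbb{R}^d$ with sides parallel to the coordinate axes and a constant $0<\gamma\le1$ such that $|(K+x)\cap\omega|\ge\gamma|K|>0$ for all $x\in\mathbb{R}^d$. The fractional Laplacian $(-\Delta_x)^s$ is the selfadjoint operator on $L^2(\mathbb{R}^d)$ given by the Fourier multiplier $|\xi|^{2s}$, with domain $\{f\in L^2(\mathbb{R}^d): |\xi|^{2s}\widehat f\in L^2(\mathbb{R}^d)\}$. Exact controllability: let $A$ be a selfadjoint operator on $L^2(\mathbb{R}^d)$ and $T>0$. The equation $\partial_t f+iAf=u\mathbf{1}_\omega$, $f|_{t=0}=f_0$, is exactly controllable from $\omega$ in time $T$ if for all $f_0,f_T \in L^2(\mathbb{R}^d)$ there exists $u \in L^2((0,T)\times\mathbb{R}^d)$, supported in $(0,T)\times\omega$, such that the mild solution $f(t)=e^{-itA}f_0+\int_0^t e^{-i(t-\tau)A}(\mathbf{1}_\omega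 u(\tau,\cdot))\,d\tau$ satisfies $f(T,\cdot)=f_T$. Here $A=(-\Delta_x)^s$. *)

(* Defs.v *)
From HB Require Import structures.
From mathcomp Require Import all_boot all_order all_algebra.
From mathcomp Require Import complex.
From mathcomp Require Import all_classical all_reals all_analysis.
From mathcomp Require Import measurable_realfun.

Set Implicit Arguments.
Unset Strict Implicit.
Unset Printing Implicit Defensive.

Import Order.TTheory GRing.Theory Num.Theory.
Import numFieldNormedType.Exports.

Local Open Scope classical_set_scope.
Local Open Scope ring_scope.
Local Open Scope complex_scope.

Section tuple_cons.
Context d (T : measurableType d) (n : nat).

Definition tuple_cons (p : T * n.-tuple T) : n.+1.-tuple T :=
  [tuple of p.1 :: p.2].

Definition tuple_uncons (x : n.+1.-tuple T) : T * n.-tuple T :=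
  (thead x, [tuple of behead x]).

Lemma tuple_consK : cancel tuple_cons tuple_uncons.
Proof. by move=> [a t]; congr pair; apply/val_inj. Qed.

Lemma measurable_tuple_cons : measurable_fun setT tuple_cons.
Proof. exact: measurable_cons. Qed.

Lemma measurable_tuple_uncons : measurable_fun setT tuple_uncons.
Proof.
apply/measurable_fun_pairP; split; first exact: measurable_tnth.
exact: measurable_behead.
Qed.

End tuple_cons.


(* One step of the construction of the Borel-Lebesgue measure: the image of
   lebesgue_measure \x m under the identification of R * R^n with R^(n+1). *)
Section lebesgue_step.
Local Open Scope ereal_scope.
Context (R : realType) (n : nat).
Variable m : {sigma_finite_measure set (n.-tuple (measurableTypeR R)) -> \bar R}.

Let cons := @tuple_cons _ (measurableTypeR R) n.

Definition lebesgue_step : set (n.+1.-tuple (measurableTypeR R)) -> \bar R :=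
  pushforward (@lebesgue_measure R \x m) cons.

Let mcons : measurable_fun setT cons.
Proof. exact: measurable_tuple_cons. Qed.

Let pm : {measure set (n.+1.-tuple (measurableTypeR R)) -> \bar R} :=
  measure_function_pushforward__canonical__measure_function_Measure
    (@lebesgue_measure R \x m : {measure set _ -> \bar R}) mcons.

Let lebesgue_step0 : lebesgue_step set0 = 0.
Proof. exact: (measure0 pm). Qed.

Let lebesgue_step_ge0 A : 0 <= lebesgue_step A.
Proof. exact: (measure_ge0 pm). Qed.

Let lebesgue_step_sigma_additive : semi_sigma_additive lebesgue_step.
Proof. exact: (@measure_semi_sigma_additive _ _ _ pm). Qed.

HB.instance Definition _ := isMeasure.Build _ _ _ lebesgue_step
  lebesgue_step0 lebesgue_step_ge0 lebesgue_step_sigma_additive.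

Let lebesgue_step_sigma_finite : sigma_finite setT lebesgue_step.
Proof.
have /sigma_finiteP[F [FT ndF mF]] := sigma_finiteT (@lebesgue_measure R).
have /sigma_finiteP[G [GT ndG mG]] := sigma_finiteT m.
pose uncons := @tuple_uncons _ (measurableTypeR R) n.
exists (fun k => uncons @^-1` (F k `*` G k)).
  rewrite -preimage_bigcup; apply/seteqP; split => // x _ /=.
  have [i _ Fi] : (\bigcup_k F k) (uncons x).1 by rewrite -FT.
  have [j _ Gj] : (\bigcup_k G k) (uncons x).2 by rewrite -GT.
  exists (maxn i j) => //; split.
    by move: Fi; exact/subsetPset/ndF/leq_maxl.
  by move: Gj; exact/subsetPset/ndG/leq_maxr.
move=> k; have [mFk Fkoo] := mF k; have [mGk Gkoo] := mG k; split.
  rewrite -[X in measurable X]setTI; apply: measurable_tuple_uncons => //.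
  exact: measurableX.
rewrite /lebesgue_step /pushforward -comp_preimage.
rewrite (_ : uncons \o cons = id) ?preimage_id; last first.
  by apply/funext => p /=; rewrite /uncons /cons tuple_consK.
by rewrite product_measure1E// lte_mul_pinfty// ge0_fin_numE.
Qed.

HB.instance Definition _ := Measure_isSigmaFinite.Build _ _ _ lebesgue_step
  lebesgue_step_sigma_finite.

End lebesgue_step.

Fixpoint borel_lebesgue (R : realType) (n : nat) :
    {sigma_finite_measure set (n.-tuple (measurableTypeR R)) -> \bar R} :=
  match n with
  | 0 => dirac ([tuple] : 0.-tuple (measurableTypeR R))
  | n'.+1 => lebesgue_step (borel_lebesgue R n')
  end.

(* R^d with the sigma-algebra of Lebesgue measurable sets and the (complete)
   d-dimensional Lebesgue measure; points are tuples of coordinates. *)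
Definition euclidean (R : realType) (d : nat) :=
  caratheodory_type ((borel_lebesgue R d)^*)%mu.

HB.instance Definition _ (R : realType) (d : nat) :=
  Measurable.on (euclidean R d).

Definition lebesgue (R : realType) (d : nat) : set (euclidean R d) -> \bar R :=
  @completed_measure_extension _ _ _ (borel_lebesgue R d).

HB.instance Definition _ (R : realType) (d : nat) :=
  Measure.on (@lebesgue R d).

Lemma lebesgue_sigma_finite (R : realType) (d : nat) :
  sigma_finite setT (@lebesgue R d).
Proof. exact/completed_measure_extension_sigma_finite/sigma_finiteT. Qed.

HB.instance Definition _ (R : realType) (d : nat) :=
  Measure_isSigmaFinite.Build _ _ _ (@lebesgue R d)
    (@lebesgue_sigma_finite R d).

Arguments lebesgue R d : clear implicits.

Section vectors.
Context {R : realType} {d : nat}.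
Implicit Types x y xi : euclidean R d.

Definition coord x (i : 'I_d) : R := tnth (x : d.-tuple R) i.

Definition translate x y : euclidean R d :=
  [tuple coord x i + coord y i | i < d].

Definition dotp x y : R := \sum_(i < d) coord x i * coord y i.

Definition enorm x : R := Num.sqrt (dotp x x).

End vectors.

Section thick.
Context {R : realType} {d : nat}.

Definition cube (a : euclidean R d) (l : R) : set (euclidean R d) :=
  [set x | forall i, coord a i <= coord x i <= coord a i + l].

Definition thick (omega : set (euclidean R d)) : Prop :=
  measurable omega /\
  exists (a : euclidean R d) (l gamma : R),
    let K := cube a l in
    [/\ 0 < gamma, gamma <= 1 &
     forall x : euclidean R d,
       (gamma%:E * lebesgue R d K
          <= lebesgue R d ((translate^~ x @` K) `&` omega))%E /\
       (0 < gamma%:E * lebesgue R d K)%E].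

End thick.

Section complex_functions.
Context {R : realType} {disp : measure_display} {T : measurableType disp}.
Variable mu : {measure set T -> \bar R}.
Implicit Types (D : set T) (f g : T -> R[i]).

Definition cmod (z : R[i]) : R :=
  Num.sqrt (complex.Re z ^+ 2 + complex.Im z ^+ 2).

Definition cexpi (theta : R) : R[i] := cos theta +i* sin theta.

Definition cmeasurable D f : Prop :=
  measurable_fun D (fun x => complex.Re (f x)) /\
  measurable_fun D (fun x => complex.Im (f x)).

Definition cintegral D f : R[i] :=
  (\int[mu]_(x in D) complex.Re (f x)) +i*
  (\int[mu]_(x in D) complex.Im (f x)).

Definition L1 D f : Prop :=
  cmeasurable D f /\ (\int[mu]_(x in D) (cmod (f x))%:E < +oo)%E.

Definition L2norm D f : \bar R :=
  sqrte (\int[mu]_(x in D) (cmod (f x) ^+ 2)%:E)%E.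

Definition L2 D f : Prop := cmeasurable D f /\ (L2norm D f < +oo)%E.

End complex_functions.

(* Elements of L^2(R^d) are represented by functions; equality in L^2(R^d) is
   equality almost everywhere. *)
Section fourier.
Context {R : realType} {d : nat}.
Notation Rd := (euclidean R d).
Notation leb := (lebesgue R d).
Implicit Types (f g : Rd -> R[i]) (m : Rd -> R[i]).

Definition fourier_integral f (xi : Rd) : R[i] :=
  cintegral leb setT (fun x => cexpi (- dotp x xi) * f x).

(* The Fourier transform on L^2, extended by continuity from L^1 and L^2. *)
Definition is_fourier f (fhat : Rd -> R[i]) : Prop :=
  [/\ L2 leb setT f, L2 leb setT fhat &
   exists2 f_ : nat -> Rd -> R[i],
     (forall n, L1 leb setT (f_ n) /\ L2 leb setT (f_ n)) &
     (L2norm leb setT (f_ n \- f) @[n --> \oo] --> 0%E) /\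
     (L2norm leb setT (fourier_integral (f_ n) \- fhat)
        @[n --> \oo] --> 0%E)].

(* Graph of the Fourier multiplier m; its domain is
   {f in L^2 | m * fhat in L^2}. *)
Definition fourier_multiplier m f g : Prop :=
  exists fhat ghat,
    [/\ is_fourier f fhat, is_fourier g ghat &
     {ae leb, forall xi, ghat xi = m xi * fhat xi}].

Definition frac_laplacian (s : R) : (Rd -> R[i]) -> (Rd -> R[i]) -> Prop :=
  fourier_multiplier (fun xi => (enorm xi `^ (2 * s))%:C).

End fourier.

Section bochner.
Context {R : realType} {d : nat}.
Notation Rd := (euclidean R d).
Notation leb := (lebesgue R d).

(* v is the Bochner integral in L^2(R^d) of w over D: the simple functions
   \sum_(i < N n) \1_(A n i) g n i converge to w in L^1(D; L^2(R^d)) and their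
   integrals converge to v in L^2(R^d). *)
Definition is_bochner_integral (D : set R) (w : R -> Rd -> R[i])
    (v : Rd -> R[i]) : Prop :=
  L2 leb setT v /\
  exists (N : nat -> nat) (A : nat -> nat -> set R)
         (g : nat -> nat -> Rd -> R[i]),
    let dist n tau := L2norm leb setT
      (fun x => w tau x - \sum_(i < N n) \1_(A n i) tau * g n i x) in
    [/\ forall n i, measurable (A n i) /\ L2 leb setT (g n i),
        forall n, measurable_fun D (dist n),
        (\int[@lebesgue_measure R]_(tau in D) dist n tau)%E
          @[n --> \oo] --> 0%E &
        L2norm leb setT
          (fun x => \sum_(i < N n)
             (fine (@lebesgue_measure R (D `&` A n i)))%:C * g n i x - v x)
          @[n --> \oo] --> 0%E].

End bochner.

Section control.
Context {R : realType} {d : nat}.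
Notation Rd := (euclidean R d).
Notation leb := (lebesgue R d).
Implicit Types (A : (Rd -> R[i]) -> (Rd -> R[i]) -> Prop).
Implicit Types (U : R -> (Rd -> R[i]) -> (Rd -> R[i])).
Implicit Types (f g : Rd -> R[i]) (omega : set Rd) (t T : R).

Definition unitary_group U : Prop :=
  [/\ forall t f, L2 leb setT f ->
        L2 leb setT (U t f) /\ L2norm leb setT (U t f) = L2norm leb setT f,
      forall t f g, L2 leb setT f -> L2 leb setT g ->
        {ae leb, forall x, f x = g x} -> {ae leb, forall x, U t f x = U t g x},
      forall t (c : R[i]) f g, L2 leb setT f -> L2 leb setT g ->
        {ae leb, forall x,
           U t (fun y => c * f y + g y) x = c * U t f x + U t g x},
      forall f, L2 leb setT f ->
        {ae leb, forall x, U 0 f x = f x} /\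
        forall t t', {ae leb, forall x, U (t + t') f x = U t (U t' f) x} &
      forall f, L2 leb setT f ->
        L2norm leb setT (U t f \- f) @[t --> 0] --> 0%E].

(* U t = exp(- i t A): U is the strongly continuous unitary group whose
   generator, with its domain, is - i A. By Stone's theorem there is exactly
   one such group, up to almost everywhere equality, if A is selfadjoint.
   Unbounded operators on L^2 are given by their graphs. *)
Definition is_exp_group A U : Prop :=
  unitary_group U /\
  forall f g, A f g <->
    [/\ L2 leb setT f, L2 leb setT g &
     L2norm leb setT
       (fun x => (h^-1)%:C * (U h f x - f x) + (0 +i* 1) * g x)
       @[h --> 0^'] --> 0%E].

(* f t = exp(- i t A) f0 + \int_0^t exp(- i (t - tau) A) (1_omega u(tau)) dtau
   for 0 <= t <= T, where U t = exp(- i t A). *)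
Definition is_mild_solution U omega T (u : R * Rd -> R[i]) (f0 : Rd -> R[i])
    (f : R -> Rd -> R[i]) : Prop :=
  forall t, 0 <= t <= T -> exists v : Rd -> R[i],
    is_bochner_integral `]0, t[
      (fun tau => U (t - tau) (fun x => \1_omega x * u (tau, x))) v /\
    {ae leb, forall x, f t x = U t f0 x + v x}.

Definition exactly_controllable A omega T : Prop :=
  exists2 U, is_exp_group A U &
  forall f0 fT : Rd -> R[i], L2 leb setT f0 -> L2 leb setT fT ->
  exists (u : R * Rd -> R[i]) (f : R -> Rd -> R[i]),
    [/\ L2 (@lebesgue_measure R \x leb)%E (`]0, T[ `*` setT) u,
        {ae (@lebesgue_measure R \x leb)%E, forall p : R * Rd,
           p.1 \in `]0, T[ -> ~ omega p.2 -> u p = 0},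
        is_mild_solution U omega T u f0 f &
        {ae leb, forall x, f T x = fT x}].

End control.

(* Main.v *)
(** If the equation is exactly controllable, then every v in L^2 is reachable
    from 0, and duality gives a constant M with
      |<v, g>| <= M sup_{|t| <= T} || 1_omega e^{-itA} g ||   for all g.
    By a gliding hump (the argument behind the uniform boundedness principle)
    there can thus be no g_n of constant positive norm for which the supremum
    tends to 0 fast.  If omega is not thick, such g_n are found among the
    translates of a single g: the orbit { e^{-itA} g : |t| <= T } is compact,
    so up to a small error it lives on one large cube and is uniformly
    integrable there, while some translate of that cube meets omega in a set
    of arbitrarily small measure.

    This requires e^{-itA} to commute with translations tau on one g <> 0.  The
    Fourier transform turns tau into a unimodular factor, so A commutes with
    tau; hence for g in the domain of A the curve t |-> e^{itA} tau e^{-itA} g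
    has derivative 0.  A nonzero g in the domain is the integral over a short
    interval of the orbit of any nonzero vector, so that no inversion or
    Plancherel theorem is needed.

    L^2 is treated as a real Hilbert space for Re <f, g>. *)
From HB Require Import structures.
Require Import Defs.
From mathcomp Require Import all_boot all_order all_algebra.
From mathcomp Require Import complex.
From mathcomp Require Import all_classical all_reals all_analysis.
From mathcomp Require Import measurable_realfun.
From mathcomp Require Import ring lra.
(* imported again: [vector] shadows [Defs.coord] *)
Require Import Defs.

Set Implicit Arguments.
Unset Strict Implicit.
Unset Printing Implicit Defensive.

Import Order.TTheory GRing.Theory Num.Theory.
Import numFieldNormedType.Exports.
Local Open Scope classical_set_scope.
Local Open Scope ring_scope.

(** * Real inner product spaces *)

(** The constant M depends on v, through a control chosen for that v. The hump removes any need for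
    uniformity in v: a single v is built from the whole sequence g_n so that no M can serve it. Its
    steps have size 3^-n, so |<v, g_n>| is at least of order 3^-n, and observed norms of 3^-n / (n +
    1) are small enough to defeat every M.

    Times of both signs enter because the adjoint of e^{-i(T-t)A} is e^{i(T-t)A}.

    The group in the statement acts on functions and is linear only almost everywhere. The abstract
    arguments are therefore made for a real inner product space, and classes of functions with
    canonical representatives form such a space. Integrals of vectors over time are replaced by
    Riemann sums, or by scalar integrals after pairing with a fixed vector. *)

Record inner_product (R : realType) (V : lmodType R) (dot : V -> V -> R) :
  Prop := InnerProduct {
  dotC : forall x y, dot x y = dot y x;
  dotDl : forall x y z, dot (x + y) z = dot x z + dot y z;
  dotZl : forall a x y, dot (a *: x) y = a * dot x y;
  dot_ge0 : forall x, 0 <= dot x x;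
  dot_eq0 : forall x, dot x x = 0 -> x = 0 }.

(* sealed, so that unification never unfolds the integrals behind [dot] *)
HB.lock Definition hnorm (R : realType) (V : lmodType R) (dot : V -> V -> R)
  (x : V) : R := Num.sqrt (dot x x).
Canonical hnorm_unlockable := Unlockable hnorm.unlock.
Arguments hnorm {R V dot} x.

Section inner_product_theory.
Context {R : realType} {V : lmodType R} {dot : V -> V -> R}.
Hypothesis ip : inner_product dot.

Local Notation hnorm := (hnorm (dot := dot)).

Lemma dotDr x y z : dot z (x + y) = dot z x + dot z y.
Proof. by rewrite ![dot z _](dotC ip) (dotDl ip). Qed.

Lemma dotZr a x y : dot y (a *: x) = a * dot y x.
Proof. by rewrite ![dot y _](dotC ip) (dotZl ip). Qed.

Lemma dotNl x y : dot (- x) y = - dot x y.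
Proof. by rewrite -scaleN1r (dotZl ip) mulN1r. Qed.

Lemma dotNr x y : dot y (- x) = - dot y x.
Proof. by rewrite ![dot y _](dotC ip) dotNl. Qed.

Lemma dotBl x y z : dot (x - y) z = dot x z - dot y z.
Proof. by rewrite (dotDl ip) dotNl. Qed.

Lemma dotBr x y z : dot z (x - y) = dot z x - dot z y.
Proof. by rewrite dotDr dotNr. Qed.

Lemma dot_ext x y : (forall z, dot x z = dot y z) -> x = y.
Proof.
move=> xy; apply/eqP; rewrite -subr_eq0; apply/eqP/(dot_eq0 ip).
by rewrite dotBl xy subrr.
Qed.

Lemma dot0l x : dot 0 x = 0.
Proof. by rewrite -(scale0r 0) (dotZl ip) mul0r. Qed.

Lemma hnorm_ge0 x : 0 <= hnorm x. Proof. by rewrite unlock sqrtr_ge0. Qed.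

Lemma hnorm_sqr x : hnorm x ^+ 2 = dot x x.
Proof. by rewrite unlock sqr_sqrtr// (dot_ge0 ip). Qed.

Lemma hnorm0 : hnorm 0 = 0.
Proof. by rewrite unlock dot0l sqrtr0. Qed.

Lemma hnorm_eq0 x : hnorm x = 0 -> x = 0.
Proof.
by move=> x0; apply: (dot_eq0 ip); rewrite -hnorm_sqr x0 expr0n.
Qed.

Lemma hnormN x : hnorm (- x) = hnorm x.
Proof. by rewrite unlock dotNl dotNr opprK. Qed.

Lemma ler_hnorm_sqr x a : 0 <= a -> hnorm x ^+ 2 <= a ^+ 2 -> hnorm x <= a.
Proof.
by move=> a0; rewrite ler_pXn2r// nnegrE hnorm_ge0.
Qed.

Lemma hdistC x y : hnorm (x - y) = hnorm (y - x).
Proof. by rewrite -hnormN opprB. Qed.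

Lemma hnormZ a x : hnorm (a *: x) = `|a| * hnorm x.
Proof.
by rewrite unlock (dotZl ip) dotZr mulrA -expr2 sqrtrM ?sqr_ge0// sqrtr_sqr.
Qed.

Lemma cauchy_schwarz x y : `|dot x y| <= hnorm x * hnorm y.
Proof.
have [->|x0] := eqVneq x 0; first by rewrite dot0l normr0 hnorm0 mul0r.
have Nx : 0 < hnorm x.
  rewrite lt_neqAle hnorm_ge0 andbT eq_sym.
  by apply: contra_neq x0; exact: hnorm_eq0.
(* This vector is |x|^2 times the component of [y] orthogonal to [x]; the scaling avoids a
   division. *)
have := dot_ge0 ip (hnorm x ^+ 2 *: y - dot x y *: x).
rewrite dotBl !dotBr !(dotZl ip) !dotZr -!hnorm_sqr (dotC ip y x) => H.
have {}H : 0 <= hnorm x ^+ 2 * ((hnorm x * hnorm y) ^+ 2 - dot x y ^+ 2).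
  by apply: le_trans H _; rewrite le_eqVlt; apply/orP; left; apply/eqP; ring.
rewrite -(ler_pXn2r (n := 2))// ?nnegrE ?mulr_ge0 ?hnorm_ge0//.
by rewrite real_normK ?num_real// -subr_ge0 -(pmulr_rge0 _ (exprn_gt0 2 Nx)).
Qed.

Lemma hnormD x y : hnorm (x + y) <= hnorm x + hnorm y.
Proof.
rewrite -(ler_pXn2r (n := 2))// ?nnegrE ?addr_ge0 ?hnorm_ge0//.
rewrite hnorm_sqr (dotDl ip) !dotDr (dotC ip y x) -!hnorm_sqr.
have := le_trans (ler_norm _) (cauchy_schwarz x y); nra.
Qed.

Lemma hnormB x y : hnorm (x - y) <= hnorm x + hnorm y.
Proof. by rewrite (le_trans (hnormD _ _))// hnormN. Qed.

Lemma hdistD z x y : hnorm (x - y) <= hnorm (x - z) + hnorm (z - y).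
Proof. by rewrite (le_trans _ (hnormD _ _))// addrA subrK. Qed.

Lemma hnorm_sum (I : Type) (r : seq I) (P : pred I) (F : I -> V) :
  hnorm (\sum_(i <- r | P i) F i) <= \sum_(i <- r | P i) hnorm (F i).
Proof.
elim/big_ind2 : _ => //; first by rewrite hnorm0.
by move=> a b c e ab ce; rewrite (le_trans (hnormD _ _))// lerD.
Qed.

Lemma geometric_cauchy (v : nat -> V) :
  (forall n, hnorm (v n.+1 - v n) <= 2^-1 ^+ n) ->
  forall n m, hnorm (v n - v (n + m)%N) <= 2 * 2^-1 ^+ n.
Proof.
move=> v2 n m.
have half_ge0 k : 0 <= (2^-1 : R) ^+ k by rewrite exprn_ge0// invr_ge0.
(* The exact sum of the step bounds is kept on the right, since 2 * 2^-n alone would not pass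
   through the induction. *)
suff : hnorm (v n - v (n + m)%N) <= 2 * 2^-1 ^+ n - 2 * 2^-1 ^+ (n + m).
  by move/le_trans; apply; rewrite gerBl mulr_ge0.
elim: m => [|m IH]; first by rewrite addn0 !subrr hnorm0.
rewrite addnS (le_trans (hdistD (v (n + m)%N) _ _))//.
have := v2 (n + m)%N; rewrite (hdistC (v (n + m).+1)) exprS.
move: IH; set p := 2^-1 ^+ (n + m); set q := 2^-1 ^+ n; lra.
Qed.

(** Only sequences with geometrically small steps are tested: this is the form in which completeness
    of L2 is proved. [hcauchy_cvg] recovers arbitrary Cauchy sequences. *)
Definition hcomplete : Prop := forall v : nat -> V,
  (forall n, hnorm (v n.+1 - v n) <= 2^-1 ^+ n) ->
  exists l, forall e, 0 < e -> exists n0, forall n, (n0 <= n)%N ->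
    hnorm (v n - l) <= e.

Hypothesis complete : hcomplete.

Lemma hcauchy_cvg (v : nat -> V) :
  (forall e, 0 < e -> exists n, forall m, (n <= m)%N -> hnorm (v m - v n) <= e) ->
  exists l, forall e, 0 < e -> exists n0, forall n, (n0 <= n)%N ->
    hnorm (v n - l) <= e.
Proof.
move=> cv.
have half_gt0 (n : nat) : 0 < (2^-1 : R) ^+ n by rewrite exprn_gt0// invr_gt0.
have [N NP] : exists N : nat -> nat, forall n m, (N n <= m)%N ->
    hnorm (v m - v (N n)) <= 2^-1 * 2^-1 ^+ n.
  have /choice[N NP] (n : nat) : exists k, forall m, (k <= m)%N ->
      hnorm (v m - v k) <= 2^-1 * 2^-1 ^+ n.
    by apply: cv; rewrite mulr_gt0// invr_gt0.
  by exists N.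
have dist n a b : (N n <= a)%N -> (N n <= b)%N -> hnorm (v a - v b) <= 2^-1 ^+ n.
  move=> na nb; rewrite (le_trans (hdistD (v (N n)) _ _))//.
  rewrite (hdistC (v (N n))); have := NP _ _ na; have := NP _ _ nb; lra.
(* Running maxima make the indices nondecreasing, so two consecutive terms of [v \o M] both lie
   beyond [N n]. *)
pose M n := \max_(i < n.+1) N i.
have NM n : (N n <= M n)%N by exact: (leq_bigmax (ord_max : 'I_n.+1)).
have MM n : (M n <= M n.+1)%N.
  by rewrite {2}/M big_ord_recr /= leq_max leqnn.
have [|l lP] := complete (v := v \o M).
  by move=> n /=; apply: dist => //; rewrite (leq_trans (NM n)).
exists l => e e0; have [n1 n1P] := lP _ (divr_gt0 e0 (ltr0n _ 2)).
have [n2 n2P] := cv _ (divr_gt0 e0 (ltr0n _ 4)).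
have [k ke] : exists k, (2^-1 : R) ^+ k <= e / 2.
  have : (2^-1 : R) ^+ k @[k --> \oo] --> 0.
    by apply: cvg_expr; rewrite ger0_norm ?invr_ge0// invf_lt1// ltr1n.
  move/cvgrPdist_le => /(_ _ (divr_gt0 e0 (ltr0n _ 2)))[k _ /(_ k (leqnn k))].
  by rewrite sub0r normrN ger0_norm ?exprn_ge0 ?invr_ge0//; exists k.
have Mk (a b : nat) : (a <= b)%N -> (M a <= M b)%N.
  by move=> /subnK <-; elim: (b - a)%N => // c IH; rewrite (leq_trans IH).
exists (N k) => n kn; rewrite (le_trans (hdistD (v (M (maxn n1 k))) _ _))//.
have := n1P _ (leq_maxl n1 k) => /=.
have := dist k n (M (maxn n1 k)) kn.
move=> /(_ (leq_trans (NM k) (Mk _ _ (leq_maxr _ _)))); lra.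
Qed.

(* the sign of the n-th step, of size 3^-n, is chosen so as to enlarge
   [|dot x (g n)|]; the later steps sum up to half of its size *)
Lemma gliding_hump (g : nat -> V) : (forall n, hnorm (g n) = 1) ->
  exists x, forall n, 3^-1 ^+ n / 2 <= `|dot x (g n)|.
Proof.
move=> g1.
pose fix x n := if n is m.+1 then
  x m + ((if 0 <= dot (x m) (g m) then 1 else -1) * 3^-1 ^+ m) *: g m else 0.
have third_ge0 n : 0 <= (3^-1 : R) ^+ n by rewrite exprn_ge0 ?invr_ge0.
have xS n : hnorm (x n.+1 - x n) = 3^-1 ^+ n.
  rewrite /= addrAC subrr add0r hnormZ g1 mulr1 normrM (ger0_norm (third_ge0 n)).
  by case: ifPn => _; rewrite ?normrN normr1 mul1r.
have xg n : 3^-1 ^+ n <= `|dot (x n.+1) (g n)|.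
  rewrite /= (dotDl ip) (dotZl ip) -hnorm_sqr g1 expr1n mulr1.
  case: ifPn => [h|]; first by rewrite ger0_norm; have := third_ge0 n; lra.
  rewrite -ltNge => h; rewrite ltr0_norm; have := third_ge0 n; lra.
(* The right-hand side is the sum of 3^-j for n < j <= n + k. It is less than half of 3^-n, so half
   of the bound [xg] survives in the limit. *)
have xd n k : hnorm (x (n.+1 + k)%N - x n.+1) <=
    (3^-1 ^+ n - 3^-1 ^+ (n + k)) / 2.
  elim: k => [|k IH]; first by rewrite !addn0 !subrr hnorm0 mul0r.
  rewrite !addnS (le_trans (hdistD (x (n.+1 + k)%N) _ _))//.
  rewrite xS addSn exprS; lra.
have [|l lP] := complete (v := x).
  by move=> n; rewrite xS lerXn2r ?nnegrE ?invr_ge0// lef_pV2 ?posrE// ler_nat.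
exists l => n; apply/ler_addgt0Pr => e e0; have [m mP] := lP _ e0.
have := mP (n.+1 + m)%N (leq_addl _ _); have := xd n m; have := xg n.
have : `|dot (x n.+1) (g n)| <= `|dot l (g n)| +
    (hnorm (x (n.+1 + m)%N - l) + hnorm (x (n.+1 + m)%N - x n.+1)).
  rewrite -lerBlDl (le_trans (lerB_dist _ _))// -dotBl.
  rewrite (le_trans (cauchy_schwarz _ _))// g1 mulr1.
  by rewrite (le_trans (hdistD (x (n.+1 + m)%N) _ _))// hdistC addrC.
have := third_ge0 (n + m)%N; lra.
Qed.

End inner_product_theory.

(** * Isometric groups and their generators *)

Section unitary_groups.
Context {R : realType} {V : lmodType R} {dot : V -> V -> R}.
Hypothesis ip : inner_product dot.
Local Notation hnorm := (hnorm (dot := dot)).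

Record isometric_group (U : R -> V -> V) : Prop := IsometricGroup {
  igD : forall t x y, U t (x + y) = U t x + U t y;
  igZ : forall t a x, U t (a *: x) = a *: U t x;
  ig_norm : forall t x, hnorm (U t x) = hnorm x;
  ig0 : forall x, U 0 x = x;
  ig_add : forall t t' x, U (t + t') x = U t (U t' x);
  ig_cont : forall x (e : R), 0 < e -> exists2 r : R, 0 < r &
    forall t, `|t| <= r -> hnorm (U t x - x) <= e }.

(** [y] is the derivative of [U h x] at h = 0; for the group exp(-itA) this is -iAx, not Ax. *)
Definition generates (U : R -> V -> V) x y : Prop :=
  forall e : R, 0 < e -> exists2 r : R, 0 < r & forall h : R, h != 0 -> `|h| <= r ->
    hnorm (U h x - x - h *: y) <= e * `|h|.

(* linear identities in [V] are ring identities between inner products *)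
Ltac lmod_ring :=
  apply: (dot_ext ip) => ?; rewrite !(dotDl ip, dotNl ip, dotZl ip); ring.

Variable U : R -> V -> V.
Hypothesis HU : isometric_group U.

Lemma igB t x y : U t (x - y) = U t x - U t y.
Proof. by rewrite (igD HU) -scaleN1r (igZ HU) scaleN1r. Qed.

Lemma igK t x : U (- t) (U t x) = x.
Proof. by rewrite -(ig_add HU) addNr (ig0 HU). Qed.

Lemma igNK t x : U t (U (- t) x) = x.
Proof. by rewrite -(ig_add HU) addrN (ig0 HU). Qed.

Lemma ig_sum t (I : Type) (r : seq I) (F : I -> V) :
  U t (\sum_(i <- r) F i) = \sum_(i <- r) U t (F i).
Proof.
apply: (big_morph (U t)) => [x y|]; first exact: (igD HU).
by rewrite -[X in U t X](scale0r (0 : V)) (igZ HU) scale0r.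
Qed.

Lemma ig_dot t x y : dot (U t x) (U t y) = dot x y.
Proof.
have := ig_norm HU t (x + y); move=> /(congr1 (fun r => r ^+ 2)).
rewrite (igD HU) !(hnorm_sqr ip) !(dotDl ip) !(dotDr ip) -!(hnorm_sqr ip).
rewrite !(ig_norm HU) (dotC ip (U t y)) (dotC ip y). lra.
Qed.

Lemma ig_adjoint t x y : dot (U t x) y = dot x (U (- t) y).
Proof. by rewrite -(ig_dot (- t)) igK. Qed.

Lemma ig_commute_sub s t x : U s x - U t x = U t (U (s - t) x - x).
Proof. by rewrite igB -(ig_add HU) [t + _]addrC subrK. Qed.

Lemma ig_norm_sub s t x : hnorm (U s x - U t x) = hnorm (U (s - t) x - x).
Proof. by rewrite ig_commute_sub (ig_norm HU). Qed.

Lemma generates_ig t x y : generates U x y -> generates U (U t x) (U t y).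
Proof.
move=> xy e /xy[r r0 rP]; exists r => // h h0 hr.
rewrite -(ig_add HU) [h + t]addrC (ig_add HU) -(igZ HU) -!igB (ig_norm HU).
exact: rP.
Qed.

(** Left Riemann sum with [m] cells of length [p] for the integral of [U s x] over [0, p m]. *)
Let riemann (p : R) (m : nat) (x : V) : V := \sum_(k < m) p *: U (p *+ k) x.

Let riemannD (p : R) (m n : nat) (x : V) :
  riemann p (m + n) x = riemann p m x + U (p *+ m) (riemann p n x).
Proof.
rewrite /riemann big_split_ord /=; congr (_ + _).
rewrite ig_sum; apply: eq_bigr => i _.
by rewrite (igZ HU) -(ig_add HU) mulrnDr.
Qed.

Let riemann_near (p : R) (m : nat) (x : V) (w : R) : 0 <= p ->
  (forall s : R, 0 <= s <= p *+ m -> hnorm (U s x - x) <= w) ->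
  hnorm (riemann p m x - (p *+ m) *: x) <= p *+ m * w.
Proof.
move=> p0 xw.
have -> : (p *+ m) *: x = \sum_(k < m) p *: x.
  by rewrite sumr_const card_ord scalerMnl.
rewrite -sumrB (le_trans (hnorm_sum ip _ _ _))//.
have -> : p *+ m * w = \sum_(k < m) p * w.
  by rewrite sumr_const card_ord mulrnAl.
apply: ler_sum => i _; rewrite -scalerBr (hnormZ ip) ger0_norm// ler_wpM2l//.
by apply: xw; rewrite mulrn_wge0//= ler_wpMn2l// ltnW.
Qed.

(** The cell that starts at time s contributes U s applied to the error of the cell at 0, and U s is
    an isometry. The oscillation of the orbit near time 0 thus controls every cell. *)
Let riemann_refine (p : R) (m q : nat) (x : V) (w : R) : 0 <= p ->
  (forall s : R, 0 <= s <= p *+ q -> hnorm (U s x - x) <= w) ->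
  hnorm (riemann p (q * m) x - riemann (p *+ q) m x) <= p *+ q *+ m * w.
Proof.
move=> p0 xw; elim: m => [|m IH].
  by rewrite muln0 /riemann !big_ord0 subrr (hnorm0 ip) mulr0n mul0r.
rewrite mulnS addnC riemannD -[in riemann (p *+ q) _]addn1 riemannD opprD addrACA.
rewrite mulrS mulrDl addrC (le_trans (hnormD ip _ _))// addrC.
have -> : riemann (p *+ q) 1 x = (p *+ q) *: x.
  by rewrite /riemann big_ord1 mulr0n (ig0 HU).
rewrite [in p *+ (q * m)]mulrnA [- U _ _ + _]addrC -igB (ig_norm HU).
by rewrite lerD// riemann_near.
Qed.

(** Discrete form of U_h I_a - I_a = U_a I_h - I_h, where I_a is the integral of the orbit over
    [0, a]; for small h the right side is close to h (U_a x - x). *)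
Let riemann_shift (p : R) (m j : nat) (x : V) (w : R) : 0 <= p ->
  (forall s : R, 0 <= s <= p *+ j -> hnorm (U s x - x) <= w) ->
  hnorm (U (p *+ j) (riemann p m x) - riemann p m x -
         (p *+ j) *: (U (p *+ m) x - x)) <= 2 * (p *+ j * w).
Proof.
move=> p0 xw; have near := riemann_near p0 xw.
have E : U (p *+ j) (riemann p m x) - riemann p m x =
    U (p *+ m) (riemann p j x) - riemann p j x.
  apply/eqP; rewrite subr_eq addrAC eq_sym subr_eq; apply/eqP.
  by rewrite addrC -riemannD addnC riemannD addrC.
have -> : U (p *+ j) (riemann p m x) - riemann p m x -
    (p *+ j) *: (U (p *+ m) x - x) =
    U (p *+ m) (riemann p j x - (p *+ j) *: x) - (riemann p j x - (p *+ j) *: x).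
  rewrite E igB (igZ HU) scalerBr !opprB addrACA [RHS]addrACA.
  by congr (_ + _); rewrite addrC.
rewrite (le_trans (hnormB ip _ _))// (ig_norm HU); lra.
Qed.

Hypothesis complete : hcomplete (dot := dot).

(* [y] is the integral of [U s x] over [0, h] *)
Lemma generates_ex (x : V) : x != 0 -> exists y z : V, y != 0 /\ generates U y z.
Proof.
move=> x0.
have nx : 0 < hnorm x.
  rewrite lt_neqAle hnorm_ge0 andbT eq_sym.
  by apply: contra_neq x0; exact: (hnorm_eq0 ip).
(* On [0, h] the orbit stays within |x| / 2 of [x], which keeps its integral from vanishing. *)
have [h h0 hP] := ig_cont HU x (divr_gt0 nx (ltr0n _ 2)).
(* Dyadic meshes are nested, so [riemann_refine] compares any two of them. *)
pose p n : R := h / 2 ^+ n.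
have p_gt0 n : 0 < p n by rewrite divr_gt0// exprn_gt0.
have p2 n : p n *+ 2 ^ n = h.
  by rewrite -mulr_natr natrX divfK//.
have pD n k : p (n + k)%N *+ 2 ^ k = p n.
  rewrite -mulr_natr natrX /p exprD invfM mulrA divfK//.
have p_small e : 0 < e -> exists n0, forall n, (n0 <= n)%N -> p n <= e.
  move=> e0; have : h * (2^-1 : R) ^+ k @[k --> \oo] --> h * 0.
    apply: cvgMr; apply: cvg_expr.
    by rewrite ger0_norm ?invr_ge0// invf_lt1// ltr1n.
  rewrite mulr0 => /cvgrPdist_le => /(_ _ e0)[n0 _ nP].
  exists n0 => n /nP; rewrite sub0r normrN exprVn ger0_norm//.
  exact: (ltW (p_gt0 n)).
pose S n := riemann (p n) (2 ^ n) x.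
have [|y yP] := hcauchy_cvg ip complete (v := S).
  move=> e e0; have eh : 0 < e / h by rewrite divr_gt0.
  have [r r0 rP] := ig_cont HU x eh.
  have [n nP] := p_small _ r0; exists n => m nm.
  rewrite /S -(subnKC nm); set k := (m - n)%N.
  have := @riemann_refine (p (n + k)%N) (2 ^ n) (2 ^ k) x (e / h).
  rewrite pD p2 -expnD [(k + n)%N]addnC [h * _]mulrC divfK ?gt_eqF//; apply.
    exact/ltW.
  move=> s /andP[s0 sp]; apply: rP; rewrite ger0_norm// (le_trans sp)//.
  exact: nP.
(* U t y is the integral of the orbit over [t, t + h], whose derivative at t = 0 is U h x - x. *)
exists y, (U h x - x); split.
  apply/eqP => y0.
  have [n0 n0P] := yP _ (divr_gt0 (mulr_gt0 h0 nx) (ltr0n _ 4)).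
  have := n0P n0 (leqnn _); rewrite y0 subr0 => H1.
  have := @riemann_near (p n0) (2 ^ n0) x (hnorm x / 2) (ltW (p_gt0 _)).
  rewrite p2 -/(S n0) => H2.
  have : hnorm (h *: x) <= hnorm (S n0) + hnorm (S n0 - h *: x).
    by rewrite hdistC// -{1}(subrK (S n0) (h *: x)) addrC (hnormD ip).
  rewrite (hnormZ ip) (gtr0_norm h0).
  have : hnorm (S n0 - h *: x) <= h * (hnorm x / 2).
    by apply: H2 => s /andP[s0 sh]; apply: hP; rewrite ger0_norm.
  have := mulr_gt0 h0 nx; lra.
(* Forward increments: [r] is rounded down to a multiple of the mesh, where [riemann_shift] applies,
   and the remaining errors add up to an arbitrary [e]. *)
have key r w : 0 < r -> (forall s, 0 <= s <= r -> hnorm (U s x - x) <= w) ->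
    hnorm (U r y - y - r *: (U h x - x)) <= r * (2 * w).
  move=> r0 rw; apply/ler_addgt0Pr => e e0.
  have e4 : 0 < e / 4 by rewrite divr_gt0.
  have [n1 n1P] := yP _ e4.
  have [d d0 dP] := ig_cont HU y e4.
  have [n2 n2P] := p_small _ d0.
  have [n3 n3P] := p_small _ (divr_gt0 e4 (mulr_gt0 (ltr0n _ 2) nx)).
  pose n := maxn n1 (maxn n2 n3); pose j := Num.truncn (r / p n).
  have jr : p n *+ j <= r.
    rewrite -mulr_natl -ler_pdivlMr// truncn_le.
    by rewrite divr_ge0// ltW.
  have rj : r <= p n *+ j + p n.
    rewrite -[X in _ + X]mulr1n -mulrnDr -mulr_natl addn1 -ler_pdivrMr// ltW//.
    exact: truncnS_gt.
  have w0 : 0 <= w by rewrite (le_trans _ (rw 0 _)) ?hnorm_ge0 ?lexx ?ltW.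
  have := @riemann_shift (p n) (2 ^ n) j x w (ltW (p_gt0 _)).
  rewrite p2 -/(S n) => H.
  have {}H : hnorm (U (p n *+ j) (S n) - S n - (p n *+ j) *: (U h x - x)) <=
      2 * (p n *+ j * w).
    by apply: H => s /andP[s0 sj]; apply: rw; rewrite s0 (le_trans sj).
  set t := p n *+ j in jr rj H; set z := U h x - x in H *.
  have nz : hnorm z <= 2 * hnorm x.
    by rewrite (le_trans (hnormB ip _ _))// (ig_norm HU); lra.
  have H1 : hnorm (U r y - U t y) <= e / 4.
    rewrite ig_norm_sub dP// ger0_norm ?subr_ge0// lerBlDl (le_trans rj)//.
    by rewrite lerD2l n2P// !leq_max leqnn orbT.
  have H2 : hnorm (S n - y) <= e / 4 by rewrite n1P// leq_max leqnn.
  have H3 : hnorm ((t - r) *: z) <= e / 4.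
    rewrite (hnormZ ip) ler0_norm ?subr_le0// opprB.
    rewrite (@le_trans _ _ (p n * (2 * hnorm x)))//.
      by rewrite ler_pM ?hnorm_ge0 ?subr_ge0// lerBlDl.
    by rewrite -ler_pdivlMr ?mulr_gt0// n3P// !leq_max leqnn !orbT.
  (* The terms come from rounding [r] to [t], from replacing [y] by [S n], from the discrete
     estimate, and from rounding [r] in the linear part; all but the third together cost at most
     e. *)
  have -> : U r y - y - r *: z = (U r y - U t y) +
      (U t (y - S n) - (y - S n)) + (U t (S n) - S n - t *: z) + (t - r) *: z.
    by rewrite igB; lmod_ring.
  have := hnormB ip (U t (y - S n)) (y - S n).
  rewrite (ig_norm HU) (hdistC ip y).
  set A := U r y - U t y in H1 *; set B := U t (y - S n) - _ => HB.
  set C := U t (S n) - _ - _ in H *; set D := (t - r) *: z in H3 *.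
  have tw : t * w <= r * w by rewrite ler_wpM2r.
  have := hnormD ip (A + B + C) D; have := hnormD ip (A + B) C.
  have := hnormD ip A B; lra.
move=> e e0; have e4 : 0 < e / 4 by rewrite divr_gt0.
have [d d0 dP] := ig_cont HU x e4.
have [d' d0' dP'] := ig_cont HU (U h x - x) e4.
exists (Num.min d d') => [|r r0]; first by rewrite lt_min d0.
rewrite le_min => /andP[rd rd'].
have {}key : hnorm (U `|r| y - y - `|r| *: (U h x - x)) <= `|r| * (2 * (e / 4)).
  apply: key => [|s /andP[s0 sr]]; first by rewrite normr_gt0.
  by rewrite dP// ger0_norm// (le_trans sr).
have [rpos|rneg] := leP 0 r.
  rewrite ger0_norm// in key *; rewrite (le_trans key)//.
  have := mulr_ge0 rpos (ltW e0); lra.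
rewrite ltr0_norm// in key *.
(* A backward increment is minus [U r] applied to the forward one of length -r, up to the
   displacement of U h x - x under [U r], which [dP'] controls. *)
have -> : U r y - y - r *: (U h x - x) =
   - (U r (U (- r) y - y - (- r) *: (U h x - x))) +
   (- r) *: (U h x - x - U r (U h x - x)).
  by rewrite !igB !(igZ HU) igNK igB; lmod_ring.
rewrite (le_trans (hnormD ip _ _))// (hnormN ip) (ig_norm HU) (hnormZ ip).
rewrite gtr0_norm ?oppr_gt0// (hdistC ip (U h x - x)).
have H := dP' r rd'.
have : - r * hnorm (U r (U h x - x) - (U h x - x)) <= - r * (e / 4).
  by rewrite ler_wpM2l// oppr_ge0 ltW.
have : 0 < - r * e by rewrite mulr_gt0// oppr_gt0.
lra.
Qed.

Lemma commute_generator (tau : V -> V) :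
  (forall x y, tau (x - y) = tau x - tau y) ->
  (forall a x, tau (a *: x) = a *: tau x) ->
  (forall x, hnorm (tau x) = hnorm x) ->
  (forall y z, generates U y z -> generates U (tau y) (tau z)) ->
  forall y z, generates U y z -> forall t, U t (tau y) = tau (U t y).
Proof.
move=> tauB tauZ taun tauU y z yz.
pose W t := U (- t) (tau (U t y)).
(* The increment of [W] has the norm of tau (U h k) - U h (tau k), where k = U t y. Both terms have
   the derivative tau (U t z) at h = 0, so it cancels. *)
have dW (t e : R) : 0 < e -> exists2 r : R, 0 < r & forall h : R, h != 0 -> `|h| <= r ->
    hnorm (W (t + h) - W t) <= e * `|h|.
  move=> e0; have e2 : 0 < e / 2 by rewrite divr_gt0.
  have k1 := generates_ig t yz.
  have [r1 r10 r1P] := k1 _ e2; have [r2 r20 r2P] := tauU _ _ k1 _ e2.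
  exists (Num.min r1 r2) => [|h h0]; first by rewrite lt_min r10.
  rewrite le_min => /andP[/(r1P _ h0) H1 /(r2P _ h0) H2].
  rewrite /W opprD [t + h]addrC !(ig_add HU) -igB (ig_norm HU).
  rewrite -(ig_norm HU h) igB igNK.
  rewrite -(taun _) !tauB tauZ in H1.
  set k := U t y in H1 H2 *; set k' := U t z in H1 H2.
  have -> : tau (U h k) - U h (tau k) = (tau (U h k) - tau k - h *: tau k') -
      (U h (tau k) - tau k - h *: tau k') by lmod_ring.
  by rewrite (le_trans (hnormB ip _ _))//; lra.
have cW t : W t = W 0.
  apply/eqP; rewrite -subr_eq0; apply/eqP; apply: (dot_eq0 ip).
  (* Pairing with a fixed vector leaves a real function with zero derivative; with this vector its
     constancy says |W t - W 0|^2 = 0. *)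
  pose phi := W t - W 0.
  have q' (s : R) : is_derive s 1 (fun s => dot (W s) phi) 0.
    set f := fun s : R => dot (W s) phi.
    have H : h^-1 *: ((f \o shift s) (h *: 1) - f s) @[h --> 0^'] --> (0 : R).
      apply/cvgrPdist_le => e e0; have phi0 : 0 < hnorm phi + 1.
        by rewrite ltr_wpDl// hnorm_ge0.
      have [r r0 rP] := dW s _ (divr_gt0 e0 phi0).
      apply/nbhs_ballP; exists r => //= h; rewrite /ball/= sub0r normrN => hr h0.
      rewrite sub0r normrN scaler1 [h + s]addrC /f -(dotBl ip) normrM normfV.
      rewrite mulrC ler_pdivrMr ?normr_gt0// (le_trans (cauchy_schwarz ip _ _))//.
      rewrite (le_trans (ler_wpM2r (hnorm_ge0 _) (rP h h0 (ltW hr))))//.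
      rewrite mulrAC ler_wpM2r// mulrAC ler_pdivrMr// ler_wpM2l ?(ltW e0)//.
      by rewrite lerDl.
    by apply: DeriveDef; [apply/cvg_ex; exists 0|exact: cvg_lim].
  have := @is_derive_0_is_cst R (fun s => dot (W s) phi) t 0 q'.
  by rewrite -/phi {1}/phi (dotBl ip) => ->; rewrite subrr.
move=> t; have := cW t; rewrite /W oppr0 !(ig0 HU) => /(congr1 (U t)).
by rewrite igNK.
Qed.

End unitary_groups.

(** * Square-integrable functions *)

Section complex_modulus.
Context {R : realType}.
Implicit Types (z w : R[i]) (a : R).
Local Open Scope complex_scope.

Lemma reD z w : complex.Re (z + w) = complex.Re z + complex.Re w.
Proof. by case: z w => [a b] [c d]. Qed.

Lemma imD z w : complex.Im (z + w) = complex.Im z + complex.Im w.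
Proof. by case: z w => [a b] [c d]. Qed.

Lemma reN z : complex.Re (- z) = - complex.Re z.
Proof. by case: z. Qed.

Lemma imN z : complex.Im (- z) = - complex.Im z.
Proof. by case: z. Qed.

Lemma reM z w : complex.Re (z * w) =
  complex.Re z * complex.Re w - complex.Im z * complex.Im w.
Proof. by case: z w => [a b] [c d]. Qed.

Lemma imM z w : complex.Im (z * w) =
  complex.Re z * complex.Im w + complex.Im z * complex.Re w.
Proof. by case: z w => [a b] [c d]. Qed.

Definition reimE := (reD, imD, reN, imN, reM, imM).

Lemma cmod_ge0 z : 0 <= cmod z. Proof. exact: sqrtr_ge0. Qed.

Lemma cmod_sqr z : cmod z ^+ 2 = complex.Re z ^+ 2 + complex.Im z ^+ 2.
Proof. by rewrite sqr_sqrtr// addr_ge0 ?sqr_ge0. Qed.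

Lemma cmod0 : cmod (0 : R[i]) = 0.
Proof. by rewrite /cmod/= expr0n addr0 sqrtr0. Qed.

Lemma cmodM z w : cmod (z * w) = cmod z * cmod w.
Proof.
rewrite /cmod -sqrtrM ?addr_ge0 ?sqr_ge0// !reimE; congr Num.sqrt; ring.
Qed.

Lemma cmod_sqrD_le z w : cmod (z + w) ^+ 2 <= 2 * (cmod z ^+ 2 + cmod w ^+ 2).
Proof.
rewrite !cmod_sqr !reimE -subr_ge0.
set x := (X in 0 <= X).
have -> : x = (complex.Re z - complex.Re w) ^+ 2 +
    (complex.Im z - complex.Im w) ^+ 2 by rewrite /x; ring.
by rewrite addr_ge0 ?sqr_ge0.
Qed.

Lemma cmod_cexpi a : cmod (cexpi a) = 1.
Proof. by rewrite /cmod /cexpi/= cos2Dsin2 sqrtr1. Qed.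

End complex_modulus.

(** Real part of the Hermitian product of [f] and [g], sealed like [hnorm]. *)
HB.lock Definition fdot (R : realType) (disp : measure_display)
    (T : measurableType disp) (mu : {measure set T -> \bar R})
    (f g : T -> R[i]) : R := \int[mu]_x
  (complex.Re (f x) * complex.Re (g x) + complex.Im (f x) * complex.Im (g x)).
Canonical fdot_unlockable := Unlockable fdot.unlock.
Arguments fdot {R disp T} mu f g.

Section L2_functions.
Context {R : realType} {disp : measure_display} {T : measurableType disp}.
Variable mu : {measure set T -> \bar R}.
Implicit Types (f g h : T -> R[i]) (c : R[i]) (a : R) (D : set T).
Local Open Scope complex_scope.

Lemma measurable_cmod D f : cmeasurable D f ->
  measurable_fun D (fun x => cmod (f x)).
Proof.
move=> [mf1 mf2]; apply: measurableT_comp.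
  apply: continuous_measurable_fun; exact: sqrt_continuous.
by apply: measurable_funD; exact: measurable_funX.
Qed.

Lemma measurable_cmod_sqr D f : cmeasurable D f ->
  measurable_fun D (fun x => (cmod (f x) ^+ 2)%:E).
Proof. by move=> mf; exact/measurable_EFinP/measurable_funX/measurable_cmod. Qed.

Lemma cmeasurableD D f g : cmeasurable D f -> cmeasurable D g ->
  cmeasurable D (fun x => f x + g x).
Proof.
move=> [f1 f2] [g1 g2]; split.
  by under eq_fun do rewrite reD; exact: measurable_funD.
by under eq_fun do rewrite imD; exact: measurable_funD.
Qed.

Lemma cmeasurableM D f g : cmeasurable D f -> cmeasurable D g ->
  cmeasurable D (fun x => f x * g x).
Proof.
move=> [f1 f2] [g1 g2]; split.
  by under eq_fun do rewrite reM; apply: measurable_funB; exact: measurable_funM.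
by under eq_fun do rewrite imM; apply: measurable_funD; exact: measurable_funM.
Qed.

Lemma cmeasurable_cst D c : cmeasurable D (fun=> c).
Proof. by split; exact: measurable_cst. Qed.

Lemma cmeasurable_indic D (A : set T) : measurable A ->
  cmeasurable D (\1_A : T -> R[i]).
Proof.
move=> mA; split.
  rewrite (_ : (fun _ => _) = (\1_A : T -> R)); first exact: measurable_indic.
  by apply/funext => x; rewrite !indicE; case: (_ \in _).
rewrite (_ : (fun _ => _) = (cst 0 : T -> R)); first exact: measurable_cst.
by apply/funext => x; rewrite indicE; case: (_ \in _).
Qed.

Lemma L2P f : L2 mu setT f <->
  cmeasurable setT f /\ (\int[mu]_x (cmod (f x) ^+ 2)%:E < +oo)%E.
Proof.
rewrite /L2 /L2norm; split=> -[mf]; last first.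
  by case: (integral _ _ _) => //= r _; split => //; exact: ltry.
have : (0 <= \int[mu]_x (cmod (f x) ^+ 2)%:E)%E.
  by apply: integral_ge0 => x _; rewrite lee_fin sqr_ge0.
by case: (integral _ _ _) => //= r _ _; rewrite ltry.
Qed.

Lemma L2_cmeasurable f : L2 mu setT f -> cmeasurable setT f.
Proof. by case. Qed.

Lemma L2_integrable_sqr f : L2 mu setT f ->
  mu.-integrable setT (EFin \o (fun x => cmod (f x) ^+ 2)).
Proof.
move=> /L2P[mf fy]; apply/integrableP; split; first exact: measurable_cmod_sqr.
by under eq_integral do rewrite gee0_abs ?lee_fin ?sqr_ge0//.
Qed.

Lemma le_L2 f g : cmeasurable setT f -> (forall x, cmod (f x) <= cmod (g x)) ->
  L2 mu setT g -> L2 mu setT f.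
Proof.
move=> mf fg /L2P[mg gy]; apply/L2P; split => //; apply: le_lt_trans gy.
apply: ge0_le_integral => //.
- by move=> x _; rewrite lee_fin sqr_ge0.
- exact: measurable_cmod_sqr.
- exact: measurable_cmod_sqr.
- by move=> x _; rewrite lee_fin lerXn2r// nnegrE cmod_ge0.
Qed.

Lemma L2_cst0 : L2 mu setT (fun=> 0).
Proof.
apply/L2P; split; first exact: cmeasurable_cst.
by under eq_integral do rewrite cmod0 expr0n; rewrite integral0.
Qed.

Lemma L2_scale c f : L2 mu setT f -> L2 mu setT (fun x => c * f x).
Proof.
move=> Lf; have [mf _] := Lf; apply/L2P; split.
  by apply: cmeasurableM => //; exact: cmeasurable_cst.
under eq_integral do rewrite cmodM exprMn EFinM.
rewrite (@integralZl _ _ _ mu setT _ _ (L2_integrable_sqr Lf))//.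
have := integrable_fin_num measurableT (L2_integrable_sqr Lf) => /=.
by case: (integral _ _ _) => // r _; rewrite -EFinM ltry.
Qed.

Lemma L2_add f g : L2 mu setT f -> L2 mu setT g -> L2 mu setT (fun x => f x + g x).
Proof.
move=> Lf Lg; apply/L2P; split.
  by apply: cmeasurableD; apply: L2_cmeasurable.
have Lfg := integrableD measurableT (L2_integrable_sqr Lf) (L2_integrable_sqr Lg).
have {}Lfg := integrableZl measurableT 2 Lfg.
apply: le_lt_trans (integrable_lty measurableT Lfg).
apply: ge0_le_integral => //.
- by move=> x _; rewrite lee_fin sqr_ge0.
- apply: measurable_cmod_sqr.
  by apply: cmeasurableD; apply: L2_cmeasurable.
- exact: measurable_int Lfg.
- by move=> x _ /=; rewrite -EFinD -EFinM lee_fin cmod_sqrD_le.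
Qed.

Lemma L2_opp f : L2 mu setT f -> L2 mu setT (fun x => - f x).
Proof. by move=> /(L2_scale (-1)); under eq_fun do rewrite mulN1r. Qed.

Lemma L2_sub f g : L2 mu setT f -> L2 mu setT g -> L2 mu setT (fun x => f x - g x).
Proof. by move=> Lf Lg; apply: L2_add => //; exact: L2_opp. Qed.

Lemma L2_indic (A : set T) f : measurable A -> L2 mu setT f ->
  L2 mu setT (fun x => \1_A x * f x).
Proof.
move=> mA Lf; apply: (le_L2 _ _ Lf) => [|x].
  by apply: cmeasurableM; [exact: cmeasurable_indic|case: Lf].
by rewrite indicE; case: (_ \in _); rewrite ?mul1r ?mul0r ?cmod0 ?cmod_ge0.
Qed.

Lemma fdot_integrable f g : L2 mu setT f -> L2 mu setT g -> mu.-integrable setT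
  (EFin \o (fun x =>
  complex.Re (f x) * complex.Re (g x) + complex.Im (f x) * complex.Im (g x))).
Proof.
move=> Lf Lg; have [[f1 f2] _] := Lf; have [[g1 g2] _] := Lg.
apply: (le_integrable measurableT _ _ (integrableD measurableT
  (L2_integrable_sqr Lf) (L2_integrable_sqr Lg))).
  by apply/measurable_EFinP/measurable_funD; exact: measurable_funM.
move=> x _; rewrite /= lee_fin.
rewrite [leRHS]ger0_norm ?addr_ge0 ?sqr_ge0// !cmod_sqr ler_norml.
set a := complex.Re _; set b := complex.Re _.
set c := complex.Im _; set d := complex.Im _.
have := sqr_ge0 (a - b); have := sqr_ge0 (c - d).
have := sqr_ge0 (a + b); have := sqr_ge0 (c + d); nra.
Qed.

Lemma fdotC f g : fdot mu f g = fdot mu g f.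
Proof.
rewrite unlock; apply: eq_Rintegral => x _.
by rewrite mulrC [_ * complex.Im _]mulrC.
Qed.

Lemma fdotDl f g h : L2 mu setT f -> L2 mu setT g -> L2 mu setT h ->
  fdot mu (fun x => f x + g x) h = fdot mu f h + fdot mu g h.
Proof.
move=> Lf Lg Lh; rewrite unlock -RintegralD//; try exact: fdot_integrable.
by apply: eq_Rintegral => x _; rewrite !reimE; ring.
Qed.

Lemma fdotZl a f g : L2 mu setT f -> L2 mu setT g ->
  fdot mu (fun x => a%:C * f x) g = a * fdot mu f g.
Proof.
move=> Lf Lg; rewrite unlock -RintegralZl//; last exact: fdot_integrable.
by apply: eq_Rintegral => x _; rewrite !reimE /=; ring.
Qed.

Lemma fdot_sqr f : fdot mu f f = \int[mu]_x (cmod (f x) ^+ 2).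
Proof. by rewrite unlock; apply: eq_Rintegral => x _; rewrite cmod_sqr. Qed.

Lemma fdot_ge0 f : 0 <= fdot mu f f.
Proof. by rewrite fdot_sqr Rintegral_ge0// => x _; rewrite sqr_ge0. Qed.

Lemma fdot_sqrE f : L2 mu setT f ->
  (\int[mu]_x (cmod (f x) ^+ 2)%:E)%E = (fdot mu f f)%:E.
Proof.
move=> Lf; rewrite fdot_sqr /Rintegral fineK//.
exact: (integrable_fin_num measurableT (L2_integrable_sqr Lf)).
Qed.

Lemma L2normE f : L2 mu setT f -> L2norm mu setT f = (Num.sqrt (fdot mu f f))%:E.
Proof. by move=> Lf; rewrite /L2norm fdot_sqrE. Qed.

Lemma fdot_eq0 f : L2 mu setT f -> fdot mu f f = 0 ->
  {ae mu, forall x, f x = 0}.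
Proof.
move=> Lf f0; have mf := L2_cmeasurable Lf.
have /(ae_eq_integral_abs mu measurableT (measurable_cmod_sqr mf)) :
    (\int[mu]_x `|(cmod (f x) ^+ 2)%:E| = 0)%E.
  under eq_integral do rewrite gee0_abs ?lee_fin ?sqr_ge0//.
  by rewrite fdot_sqrE// f0.
apply: filterS => x /(_ I) [] /eqP; rewrite cmod_sqr.
rewrite paddr_eq0 ?sqr_ge0// !sqrf_eq0 => /andP[/eqP re0 /eqP im0].
by apply/eqP; rewrite eq_complex re0 im0 !eqxx.
Qed.

Lemma eq_ae_fdot f f' g g' : L2 mu setT f -> L2 mu setT f' ->
  L2 mu setT g -> L2 mu setT g' -> {ae mu, forall x, f x = f' x} ->
  {ae mu, forall x, g x = g' x} -> fdot mu f g = fdot mu f' g'.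
Proof.
move=> Lf Lf' Lg Lg' ff' gg'; rewrite unlock; congr fine; apply: ae_eq_integral => //.
- exact: measurable_int (fdot_integrable Lf Lg).
- exact: measurable_int (fdot_integrable Lf' Lg').
- by apply: filterS2 ff' gg' => x -> ->.
Qed.

End L2_functions.

(** * Completeness of the space of square-integrable functions *)

Section L2_complete.
Context {R : realType} {disp : measure_display} {T : measurableType disp}.
Variable mu : {measure set T -> \bar R}.
Implicit Types (f g h : T -> R[i]).
Local Open Scope complex_scope.

(* 2 |h_n| <= 2^-n + 2^n |h_n|^2 *)
Lemma ae_summable_sqr (h : nat -> T -> R[i]) :
  (forall n, L2 mu setT (h n)) ->
  (forall n, fdot mu (h n) (h n) <= 4^-1 ^+ n) ->
  exists G, [/\ measurable G, {ae mu, forall x, G x} & forall x, G x ->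
    exists M, forall n, \sum_(k < n) cmod (h k x) <= M].
Proof.
move=> Lh h4.
(* The weight 2^n is the one in the pointwise inequality, and it leaves integrals of at most
   2^-n. *)
pose F n x : \bar R := (2 ^+ n * cmod (h n x) ^+ 2)%:E.
pose s x := (\sum_(n <oo) F n x)%E.
have F0 n x : (0 <= F n x)%E by rewrite lee_fin mulr_ge0 ?exprn_ge0 ?cmod_ge0.
have mF n : measurable_fun setT (F n).
  apply/measurable_EFinP; apply: measurable_funM; first exact: measurable_cst.
  by apply/measurable_funX/measurable_cmod/(L2_cmeasurable (Lh n)).
have ms : measurable_fun setT s by exact: ge0_emeasurable_sum.
have FE n : (\int[mu]_x F n x = (2 ^+ n * fdot mu (h n) (h n))%:E)%E.
  under eq_integral do rewrite /F EFinM.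
  rewrite ge0_integralZl_EFin ?exprn_ge0//; last 2 first.
  - by move=> x _; rewrite lee_fin sqr_ge0.
  - exact/measurable_cmod_sqr/(L2_cmeasurable (Lh n)).
  by rewrite fdot_sqrE// -EFinM.
have sint : (\int[mu]_x s x <= 2%:E)%E.
  rewrite integral_nneseries//; apply: lime_le.
    by apply: is_cvg_nneseries => n _ _; apply: integral_ge0.
  near=> n.
  under eq_bigr do rewrite FE.
  rewrite sumEFin lee_fin big_mkord.
  rewrite (@le_trans _ _ (2 - 2 * 2^-1 ^+ n))//; last first.
    by rewrite gerBl mulr_ge0// exprn_ge0// invr_ge0.
  elim: {+}n => [|k IH]; first by rewrite big_ord0 expr0 mulr1 subrr.
  rewrite big_ord_recr/= exprS.
  have : 2 ^+ k * fdot mu (h k) (h k) <= 2^-1 ^+ k.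
    rewrite (le_trans (ler_wpM2l _ (h4 k))) ?exprn_ge0// -exprMn.
    by rewrite (_ : 2 * 4^-1 = 2^-1)//; field.
  lra.
exists (setT `&` [set x | (s x < +oo)%E]); split.
- exact: emeasurable_fun_infty_o.
- have /(integrable_ae measurableT) : mu.-integrable setT s.
    apply/integrableP; split => //.
    under eq_integral do rewrite gee0_abs ?nneseries_ge0//.
    by rewrite (le_lt_trans sint)// ltry.
  by apply: filterS => x /(_ I); rewrite fin_numElt => /andP[_ sy].
move=> x [_ /= sx].
have s0 : (0 <= s x)%E by exact: nneseries_ge0.
exists ((2 + fine (s x)) / 2) => n.
have H : \sum_(k < n) (2 ^+ k * cmod (h k x) ^+ 2) <= fine (s x).
  rewrite -lee_fin fineK ?ge0_fin_numE// -sumEFin -(big_mkord xpredT (fun k => F k x)).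
  exact: nneseries_lim_ge.
have H2 : \sum_(k < n) (2^-1 : R) ^+ k <= 2.
  rewrite (@le_trans _ _ (2 - 2 * 2^-1 ^+ n))//; last first.
    by rewrite gerBl mulr_ge0// exprn_ge0// invr_ge0.
  elim: {+}n => [|k IH]; first by rewrite big_ord0 expr0 mulr1 subrr.
  by rewrite big_ord_recr/= exprS; set p := 2^-1 ^+ k in IH *; lra.
rewrite ler_pdivlMr// mulr_suml (le_trans _ (lerD H2 H))// -big_split/=.
apply: ler_sum => k _; set c := cmod _.
rewrite exprVn; have : (0 : R) < 2 ^+ k by exact: exprn_gt0.
set p := 2 ^+ k => p0.
have -> : p^-1 + p * c ^+ 2 = p^-1 * (1 + (p * c) ^+ 2) by field; rewrite gt_eqF.
rewrite mulrC ler_pdivlMl//; have := sqr_ge0 (p * c - 1); nra.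
Unshelve. all: by end_near. Qed.

Lemma bounded_variation_cvg (u : R^nat) M :
  (forall n, \sum_(k < n) `|u k.+1 - u k| <= M) -> cvgn u.
Proof.
move=> uM.
have : cvgn (series (fun k => u k.+1 - u k)).
  apply: normed_cvg; apply: nondecreasing_is_cvgn.
    rewrite /series /=; apply: nondecreasing_series => k _ _; exact: normr_ge0.
  exists M => _ [n _ <-]; have := uM n.
  by rewrite -(big_mkord xpredT (fun k => `|u k.+1 - u k|)).
move=> /cvg_ex[l ul]; apply/cvg_ex; exists (u 0%N + l).
have -> : u @ \oo = (cst (u 0%N) + series (fun k => u k.+1 - u k)) @ \oo.
  apply: (congr1 (fun v : R^nat => v @ \oo)); apply/funext => n.
  by rewrite fctE /= /series/= telescope_sumr// addrC subrK.
by apply: cvgD ul; exact: cvg_cst.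
Qed.

(** Riesz-Fischer: steps of norm at most 2^-n give convergence almost everywhere, and Fatou's lemma
    in [m] carries the bound [b n] over to the limit. *)
Lemma L2_complete (f : nat -> T -> R[i]) (b : nat -> R) :
  (forall n, L2 mu setT (f n)) ->
  (forall n, fdot mu (fun x => f n.+1 x - f n x) (fun x => f n.+1 x - f n x)
     <= 4^-1 ^+ n) ->
  (forall n m, fdot mu (fun x => f n x - f (n + m)%N x)
                       (fun x => f n x - f (n + m)%N x) <= b n) ->
  exists2 g, L2 mu setT g & forall n,
    fdot mu (fun x => f n x - g x) (fun x => f n x - g x) <= b n.
Proof.
move=> Lf f4 fb.
have [||G [mG aeG Gcvg]] := @ae_summable_sqr (fun n x => f n.+1 x - f n x).
- by move=> n; exact: L2_sub.
- exact: f4.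
(* Cutting off to the set [G] of full measure makes the limits exist everywhere, which yields a
   measurable limit even if [mu] is not complete. *)
pose f' n x := \1_G x * f n x.
have Lf' n : L2 mu setT (f' n) by exact: L2_indic.
have ff' n : {ae mu, forall x, f' n x = f n x}.
  by apply: filterS aeG => x Gx; rewrite /f' indicE mem_set// mul1r.
have cvgf' x : cvgn (fun n => complex.Re (f' n x)) /\
    cvgn (fun n => complex.Im (f' n x)).
  have [Gx|nGx] := pselect (G x); last first.
    rewrite (_ : (fun _ => _) = cst 0); last first.
      by apply/funext => n; rewrite /f' indicE memNset// mul0r.
    rewrite (_ : (fun _ => _) = cst 0); last first.
      by apply/funext => n; rewrite /f' indicE memNset// mul0r.
    by split; exact: is_cvg_cst.
  have [M xM] := Gcvg _ Gx.
  by split; apply: (@bounded_variation_cvg _ M) => n; apply: le_trans (xM n);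
    apply: ler_sum => k _; rewrite /f' indicE mem_set// !mul1r -?reN -?imN
      -?reD -?imD -sqrtr_sqr /cmod ler_sqrt ?addr_ge0 ?sqr_ge0//
      ?lerDl ?lerDr sqr_ge0.
pose g x := limn (fun n => complex.Re (f' n x)) +i*
            limn (fun n => complex.Im (f' n x)).
have mg : cmeasurable setT g.
  split.
    apply: (@measurable_fun_cvg _ _ _ _ (fun n x => complex.Re (f' n x))).
      by move=> n; have [[]] := Lf' n.
    by move=> x _; exact: (cvgf' x).1.
  apply: (@measurable_fun_cvg _ _ _ _ (fun n x => complex.Im (f' n x))).
    by move=> n; have [[]] := Lf' n.
  by move=> x _; exact: (cvgf' x).2.
have cvg_sqr n x : (cmod (f' n x - f' (n + m)%N x) ^+ 2)%:E @[m --> \oo] -->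
    (cmod (f' n x - g x) ^+ 2)%:E.
  apply: cvg_EFin; first exact: nearW.
  rewrite cmod_sqr !expr2; under eq_fun do rewrite /= cmod_sqr reD imD reN imN !expr2.
  rewrite reD imD reN imN; have [c1 c2] := cvgf' x.
  have c1' : complex.Re (f' (n + m)%N x) @[m --> \oo] --> complex.Re (g x).
    have : complex.Re (f' m x) @[m --> \oo] --> complex.Re (g x) by exact: c1.
    by rewrite -(cvg_shiftn n); under eq_fun do rewrite /= addnC.
  have c2' : complex.Im (f' (n + m)%N x) @[m --> \oo] --> complex.Im (g x).
    have : complex.Im (f' m x) @[m --> \oo] --> complex.Im (g x) by exact: c2.
    by rewrite -(cvg_shiftn n); under eq_fun do rewrite /= addnC.
  have cR : (complex.Re (f' n x) - complex.Re (f' (n + m)%N x)) @[m --> \oo] -->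
      (complex.Re (f' n x) - complex.Re (g x)).
    by apply: cvgB => //; exact: cvg_cst.
  have cI : (complex.Im (f' n x) - complex.Im (f' (n + m)%N x)) @[m --> \oo] -->
      (complex.Im (f' n x) - complex.Im (g x)).
    by apply: cvgB => //; exact: cvg_cst.
  by apply: cvgD; apply: cvgM.
have mD n m : measurable_fun setT
    (fun x => (cmod (f' n x - f' (n + m)%N x) ^+ 2)%:E).
  apply/measurable_cmod_sqr/L2_cmeasurable; exact: L2_sub.
have mgn n : cmeasurable setT (fun x => f' n x - g x).
  have [[f1 f2] _] := Lf' n; have [g1 g2] := mg.
  by split; [under eq_fun do rewrite reD reN|under eq_fun do rewrite imD imN];
    exact: measurable_funB.
have bound n : (\int[mu]_x (cmod (f' n x - g x) ^+ 2)%:E <= (b n)%:E)%E.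
  have -> : (\int[mu]_x (cmod (f' n x - g x) ^+ 2)%:E =
      \int[mu]_x limn_einf (fun m => (cmod (f' n x - f' (n + m)%N x) ^+ 2)%:E))%E.
    by apply: eq_integral => x _; rewrite (cvg_limn_einf_sup (cvg_sqr n x)).1.
  apply: le_trans (fatou _ measurableT _ _) _ => //.
    by move=> m x _; rewrite lee_fin sqr_ge0.
  rewrite limn_einf_lim; apply: lime_le; first exact: is_cvg_einfs.
  apply: nearW => m; apply: (@le_trans _ _ (fdot mu
      (fun x => f n x - f (n + m)%N x) (fun x => f n x - f (n + m)%N x))%:E).
    apply: ereal_inf_lbound; exists m => //=.
    rewrite fdot_sqrE; last exact: L2_sub.
    congr EFin; apply: eq_ae_fdot; try exact: L2_sub.
      by apply: filterS2 (ff' n) (ff' (n + m)%N) => x -> ->.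
    by apply: filterS2 (ff' n) (ff' (n + m)%N) => x -> ->.
  by rewrite lee_fin.
have Lfg n : L2 mu setT (fun x => f' n x - g x).
  by apply/L2P; split => //; rewrite (le_lt_trans (bound n))// ltry.
have Lg : L2 mu setT g.
  have := L2_sub (Lf' 0%N) (Lfg 0%N).
  by under eq_fun do rewrite opprB addrC subrK.
exists g => // n; rewrite -lee_fin -fdot_sqrE; last exact: L2_sub.
apply: le_trans (bound n); rewrite le_eqVlt; apply/orP; left; apply/eqP.
apply: ge0_ae_eq_integral => //.
- exact/measurable_cmod_sqr/L2_cmeasurable/L2_sub.
- exact: measurable_cmod_sqr.
- by move=> x _; rewrite lee_fin sqr_ge0.
- by move=> x _; rewrite lee_fin sqr_ge0.
- by apply: filterS (ff' n) => x ->.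
Qed.

End L2_complete.

(** * The Hilbert space L2 *)

(* classes of square-integrable functions modulo equality almost everywhere,
   realised by chosen representatives *)
Section L2_space.
Context {R : realType} {disp : measure_display} {T : measurableType disp}.
Variable mu : {measure set T -> \bar R}.
Implicit Types (f g h : T -> R[i]).
Local Open Scope complex_scope.

Definition L2canon f : T -> R[i] :=
  xget (fun=> 0) [set g | L2 mu setT g /\ {ae mu, forall x, f x = g x}].

Lemma L2canonP f : L2 mu setT f ->
  L2 mu setT (L2canon f) /\ {ae mu, forall x, f x = L2canon f x}.
Proof.
move=> Lf; apply: (@xgetPex _ (fun=> 0)
  [set g | L2 mu setT g /\ {ae mu, forall x, f x = g x}]).
by exists f; split => //; exact: aeW.
Qed.

(** Both representatives are chosen from the same set of candidates, so they coincide as functions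
    and not merely almost everywhere. *)
Lemma eq_L2canon f g : {ae mu, forall x, f x = g x} -> L2canon f = L2canon g.
Proof.
move=> fg; congr xget; apply/seteqP; split => h [Lh fh]; split => //.
  by apply: filterS2 fg fh => x -> ->.
by apply: filterS2 fg fh => x -> ->.
Qed.

Lemma L2canon_id f : L2 mu setT f -> L2canon (L2canon f) = L2canon f.
Proof. by move=> /L2canonP[_ H]; rewrite -(eq_L2canon H). Qed.

(** The condition is reflected into a boolean so that its proofs are irrelevant: elements with the
    same underlying function are equal. *)
Record L2space : Type := L2Space {
  L2fun :> T -> R[i];
  L2space_subproof : `[< L2 mu setT L2fun /\ L2canon L2fun = L2fun >] }.

HB.instance Definition _ := [isSub for L2fun].
HB.instance Definition _ := [Choice of L2space by <:].

Lemma L2fun_L2 (v : L2space) : L2 mu setT v.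
Proof. by have /asboolP[] := L2space_subproof v. Qed.

Lemma L2fun_canon (v : L2space) : L2canon v = v.
Proof. by have /asboolP[] := L2space_subproof v. Qed.

(** Makes [L2class] a total function, unspecified off L2, so that the operations on classes carry no
    proof of integrability. *)
Lemma L2class_subproof f :
  {v : L2space | L2 mu setT f -> L2fun v = L2canon f}.
Proof.
apply: cid; have key g : L2 mu setT g -> exists v : L2space, L2fun v = L2canon g.
  move=> Lg; have H : `[< L2 mu setT (L2canon g) /\
      L2canon (L2canon g) = L2canon g >].
    by apply/asboolP; split; [case: (L2canonP Lg)|exact: L2canon_id].
  by exists (L2Space H).
have [/key[v vf]|nLf] := pselect (L2 mu setT f); first by exists v.
by have [v _] := key _ (L2_cst0 mu); exists v.
Qed.

Definition L2class f : L2space := sval (L2class_subproof f).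

Lemma L2classE f : L2 mu setT f -> L2fun (L2class f) = L2canon f.
Proof. by move=> Lf; rewrite /L2class; case: L2class_subproof => /= v ->. Qed.

Lemma ae_L2class f : L2 mu setT f -> {ae mu, forall x, L2class f x = f x}.
Proof.
move=> Lf; rewrite L2classE//; have [_] := L2canonP Lf.
by apply: filterS => x ->.
Qed.

Lemma L2fun_inj (v w : L2space) : {ae mu, forall x, v x = w x} -> v = w.
Proof.
by move=> vw; apply: val_inj; rewrite /= -L2fun_canon -[RHS]L2fun_canon;
  exact: eq_L2canon.
Qed.

Lemma eq_L2class f g : L2 mu setT f -> L2 mu setT g ->
  {ae mu, forall x, f x = g x} -> L2class f = L2class g.
Proof.
move=> Lf Lg fg; apply: L2fun_inj; rewrite !L2classE// (eq_L2canon fg).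
exact: aeW.
Qed.

Lemma L2funK (v : L2space) : L2class v = v.
Proof. by apply: L2fun_inj; exact/ae_L2class/L2fun_L2. Qed.

Definition L2space_zero : L2space := L2class (fun=> 0).
Definition L2space_opp (v : L2space) : L2space := L2class (fun x => - v x).
Definition L2space_add (v w : L2space) : L2space := L2class (fun x => v x + w x).
Definition L2space_scale (a : R) (v : L2space) : L2space :=
  L2class (fun x => a%:C * v x).

Lemma ae_L2zero : {ae mu, forall x, L2space_zero x = 0}.
Proof. exact/ae_L2class/L2_cst0. Qed.

Lemma ae_L2opp v : {ae mu, forall x, L2space_opp v x = - v x}.
Proof. exact/ae_L2class/L2_opp/L2fun_L2. Qed.

Lemma ae_L2add v w : {ae mu, forall x, L2space_add v w x = v x + w x}.
Proof. by apply/ae_L2class/L2_add; exact: L2fun_L2. Qed.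

Lemma ae_L2scale a v : {ae mu, forall x, L2space_scale a v x = a%:C * v x}.
Proof. exact/ae_L2class/L2_scale/L2fun_L2. Qed.

Lemma L2space_addA : associative L2space_add.
Proof.
move=> u v w; apply: L2fun_inj; near=> x.
rewrite (near (ae_L2add u (L2space_add v w)) x)// (near (ae_L2add v w) x)//.
rewrite (near (ae_L2add (L2space_add u v) w) x)// (near (ae_L2add u v) x)//.
by rewrite addrA.
Unshelve. all: by end_near. Qed.

Lemma L2space_addC : commutative L2space_add.
Proof.
by move=> u v; congr L2class; apply/funext => x; rewrite addrC.
Qed.

Lemma L2space_add0 : left_id L2space_zero L2space_add.
Proof.
move=> u; apply: L2fun_inj; near=> x.
rewrite (near (ae_L2add L2space_zero u) x)// (near ae_L2zero x)//.
by rewrite add0r.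
Unshelve. all: by end_near. Qed.

Lemma L2space_addN : left_inverse L2space_zero L2space_opp L2space_add.
Proof.
move=> u; apply: L2fun_inj; near=> x.
rewrite (near (ae_L2add (L2space_opp u) u) x)// (near ae_L2zero x)//.
by rewrite (near (ae_L2opp u) x)// addNr.
Unshelve. all: by end_near. Qed.

HB.instance Definition _ := GRing.isZmodule.Build L2space
  L2space_addA L2space_addC L2space_add0 L2space_addN.

Lemma L2space_scaleA a b v :
  L2space_scale a (L2space_scale b v) = L2space_scale (a * b) v.
Proof.
apply: L2fun_inj; near=> x.
rewrite (near (ae_L2scale a (L2space_scale b v)) x)//.
rewrite (near (ae_L2scale b v) x)// (near (ae_L2scale (a * b) v) x)//.
by rewrite rmorphM mulrA.
Unshelve. all: by end_near. Qed.

Lemma L2space_scale1 : left_id 1 L2space_scale.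
Proof.
move=> u; apply: L2fun_inj; near=> x.
by rewrite (near (ae_L2scale 1 u) x)// rmorph1 mul1r.
Unshelve. all: by end_near. Qed.

Lemma L2space_scaleDr : right_distributive L2space_scale +%R.
Proof.
move=> a u v; apply: L2fun_inj; near=> x.
rewrite (near (ae_L2scale a (u + v)) x)// (near (ae_L2add u v) x)//.
rewrite (near (ae_L2add (L2space_scale a u) (L2space_scale a v)) x)//.
rewrite (near (ae_L2scale a u) x)// (near (ae_L2scale a v) x)//.
by rewrite mulrDr.
Unshelve. all: by end_near. Qed.

Lemma L2space_scaleDl v :
  {morph L2space_scale^~ v : a b / a + b}.
Proof.
move=> a b; apply: L2fun_inj; near=> x.
rewrite (near (ae_L2scale (a + b) v) x)//.
rewrite (near (ae_L2add (L2space_scale a v) (L2space_scale b v)) x)//.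
rewrite (near (ae_L2scale a v) x)// (near (ae_L2scale b v) x)//.
by rewrite rmorphD mulrDl.
Unshelve. all: by end_near. Qed.

HB.instance Definition _ := GRing.Zmodule_isLmodule.Build R L2space
  L2space_scaleA L2space_scale1 L2space_scaleDr L2space_scaleDl.

Lemma ae_L2sub (v w : L2space) : {ae mu, forall x, (v - w) x = v x - w x}.
Proof.
near=> x; rewrite (near (ae_L2add v (- w)) x)//.
by rewrite (near (ae_L2opp w) x).
Unshelve. all: by end_near. Qed.

Lemma L2classD f g : L2 mu setT f -> L2 mu setT g ->
  L2class (fun x => f x + g x) = L2class f + L2class g.
Proof.
move=> Lf Lg; apply: L2fun_inj; near=> x.
rewrite (near (ae_L2class (L2_add Lf Lg)) x)//.
rewrite (near (ae_L2add (L2class f) (L2class g)) x)//.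
by rewrite (near (ae_L2class Lf) x)// (near (ae_L2class Lg) x).
Unshelve. all: by end_near. Qed.

Lemma L2classB f g : L2 mu setT f -> L2 mu setT g ->
  L2class (fun x => f x - g x) = L2class f - L2class g.
Proof.
move=> Lf Lg; apply: L2fun_inj; near=> x.
rewrite (near (ae_L2class (L2_sub Lf Lg)) x)//.
rewrite (near (ae_L2sub (L2class f) (L2class g)) x)//.
by rewrite (near (ae_L2class Lf) x)// (near (ae_L2class Lg) x).
Unshelve. all: by end_near. Qed.

Lemma L2classZ (a : R) f : L2 mu setT f ->
  L2class (fun x => a%:C * f x) = a *: L2class f.
Proof.
move=> Lf; apply: L2fun_inj; near=> x.
rewrite (near (ae_L2class (L2_scale a%:C Lf)) x)//.
rewrite (near (ae_L2scale a (L2class f)) x)//.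
by rewrite (near (ae_L2class Lf) x).
Unshelve. all: by end_near. Qed.

Definition L2dot (v w : L2space) : R := fdot mu v w.

Lemma L2dotE f g : L2 mu setT f -> L2 mu setT g ->
  L2dot (L2class f) (L2class g) = fdot mu f g.
Proof.
by move=> Lf Lg; apply: eq_ae_fdot => //; try exact: L2fun_L2; exact: ae_L2class.
Qed.

Lemma L2dotP : inner_product L2dot.
Proof.
split.
- by move=> u v; exact: fdotC.
- move=> u v w; rewrite /L2dot -fdotDl; try exact: L2fun_L2.
  apply: eq_ae_fdot; try exact: L2fun_L2; last exact: aeW.
    by apply: L2_add; exact: L2fun_L2.
  exact: ae_L2add.
- move=> a u v; rewrite /L2dot -fdotZl; try exact: L2fun_L2.
  apply: eq_ae_fdot; try exact: L2fun_L2; last exact: aeW.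
    by apply: L2_scale; exact: L2fun_L2.
  exact: ae_L2scale.
- by move=> u; exact: fdot_ge0.
- move=> u u0; apply: L2fun_inj.
  apply: filterS2 (fdot_eq0 (L2fun_L2 u) u0) ae_L2zero => x -> z0.
  by symmetry.
Qed.

Lemma L2space_complete : hcomplete (dot := L2dot).
Proof.
move=> v v2.
have ip := L2dotP.
have subE m n : fdot mu (fun x => v m x - v n x) (fun x => v m x - v n x) =
    hnorm (dot := L2dot) (v m - v n) ^+ 2.
  rewrite (hnorm_sqr ip); apply: eq_ae_fdot; try exact: L2fun_L2;
    try (apply: L2_sub; exact: L2fun_L2).
    by apply: filterS (ae_L2sub (v m) (v n)) => x ->.
  by apply: filterS (ae_L2sub (v m) (v n)) => x ->.
have vb := geometric_cauchy ip v2.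
have half_ge0 (n : nat) : 0 <= (2^-1 : R) ^+ n by rewrite exprn_ge0// invr_ge0.
(* The bound is that of [geometric_cauchy], squared because [L2_complete] speaks of squared
   norms. *)
have [|||g Lg gP] := @L2_complete _ _ _ mu v (fun n => (2 * 2^-1 ^+ n) ^+ 2).
- by move=> n; exact: L2fun_L2.
- move=> n; rewrite subE (_ : 4^-1 = 2^-1 ^+ 2); last by field.
  by rewrite exprAC lerXn2r// nnegrE// hnorm_ge0.
- move=> n m; rewrite subE lerXn2r// ?nnegrE ?hnorm_ge0 ?mulr_ge0//.
exists (L2class g) => e e0.
have : 2 * (2^-1 : R) ^+ k @[k --> \oo] --> (2 * 0 : R).
  apply: cvgMr; apply: cvg_expr.
  by rewrite ger0_norm ?invr_ge0// invf_lt1// ltr1n.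
rewrite mulr0 => /cvgrPdist_le => /(_ _ e0)[n0 _ nP].
exists n0 => n /nP; rewrite sub0r normrN ger0_norm ?mulr_ge0//; apply: le_trans.
rewrite -(ler_pXn2r (n := 2))// ?nnegrE ?hnorm_ge0 ?mulr_ge0//.
apply: le_trans (gP n); rewrite (hnorm_sqr ip) le_eqVlt; apply/orP; left; apply/eqP.
apply: eq_ae_fdot; try exact: L2fun_L2; try (apply: L2_sub => //; exact: L2fun_L2).
  by apply: filterS2 (ae_L2sub (v n) (L2class g)) (ae_L2class Lg) => x -> ->.
by apply: filterS2 (ae_L2sub (v n) (L2class g)) (ae_L2class Lg) => x -> ->.
Qed.

Lemma L2norm_hnorm f : L2 mu setT f ->
  L2norm mu setT f = (hnorm (dot := L2dot) (L2class f))%:E.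
Proof. by move=> Lf; rewrite L2normE// hnorm.unlock L2dotE. Qed.

Lemma L2class_norm_sqr f : L2 mu setT f ->
  (\int[mu]_x (cmod (f x) ^+ 2)%:E)%E =
  (hnorm (dot := L2dot) (L2class f) ^+ 2)%:E.
Proof. by move=> Lf; rewrite fdot_sqrE// (hnorm_sqr L2dotP) L2dotE. Qed.

Lemma L2class_norm_le f g : L2 mu setT f -> L2 mu setT g ->
  (forall x, cmod (f x) <= cmod (g x)) ->
  hnorm (dot := L2dot) (L2class f) <= hnorm (dot := L2dot) (L2class g).
Proof.
move=> Lf Lg fg; apply: ler_hnorm_sqr; first exact: hnorm_ge0.
rewrite -lee_fin -(L2class_norm_sqr Lf) -(L2class_norm_sqr Lg).
apply: ge0_le_integral; first exact: measurableT.
- by move=> x _; rewrite lee_fin sqr_ge0.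
- exact: (measurable_cmod_sqr (L2_cmeasurable Lf)).
- exact: (measurable_cmod_sqr (L2_cmeasurable Lg)).
- by move=> x _; rewrite lee_fin lerXn2r ?nnegrE ?cmod_ge0.
Qed.

End L2_space.

(** * Measure-preserving maps and unitary groups on L2 *)

Section measure_preserving.
Context {R : realType} {disp : measure_display} {T : measurableType disp}.
Variable mu : {measure set T -> \bar R}.
Variable phi : T -> T.
Hypothesis mphi : measurable_fun setT phi.
Hypothesis phi_mu : forall A, measurable A -> mu (phi @^-1` A) = mu A.
Implicit Types f g : T -> R[i].

Lemma ge0_integral_comp (h : T -> \bar R) : measurable_fun setT h ->
  (forall y, 0 <= h y)%E -> (\int[mu]_y h (phi y) = \int[mu]_y h y)%E.
Proof.
move=> mh h0; have := @ge0_integral_pushforward _ _ _ _ _ _ mphi mu setT h.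
rewrite preimage_setT => <- //.
by apply: eq_measure_integral => A mA _; exact: phi_mu.
Qed.

Lemma integral_comp (h : T -> \bar R) : measurable_fun setT h ->
  (\int[mu]_y h (phi y) = \int[mu]_y h y)%E.
Proof.
move=> mh; rewrite integralE [RHS]integralE; congr (_ - _)%E.
  have <- // := @ge0_integral_comp (h^\+)%E (measurable_funepos mh).
  by apply: eq_integral => y _; rewrite !funeposE.
have <- // := @ge0_integral_comp (h^\-)%E (measurable_funeneg mh).
by apply: eq_integral => y _; rewrite !funenegE.
Qed.

Lemma cmeasurable_comp f : cmeasurable setT f -> cmeasurable setT (f \o phi).
Proof.
move=> [f1 f2].
by split; [exact: (measurableT_comp f1)|exact: (measurableT_comp f2)].
Qed.

Lemma L2norm_comp f : cmeasurable setT f ->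
  L2norm mu setT (f \o phi) = L2norm mu setT f.
Proof.
move=> mf; rewrite /L2norm; congr sqrte.
rewrite -(ge0_integral_comp (measurable_cmod_sqr mf))// => y.
by rewrite lee_fin sqr_ge0.
Qed.

Lemma L2_comp f : L2 mu setT f -> L2 mu setT (f \o phi).
Proof.
by move=> [mf fy]; split; [exact: cmeasurable_comp|rewrite L2norm_comp].
Qed.

Lemma L1_comp f : L1 mu setT f -> L1 mu setT (f \o phi).
Proof.
move=> [mf fy]; split; first exact: cmeasurable_comp.
rewrite (ge0_integral_comp (h := fun x => (cmod (f x))%:E))//.
  by apply/measurable_EFinP; exact: measurable_cmod.
by move=> y; rewrite lee_fin cmod_ge0.
Qed.

Lemma ae_comp (P : T -> Prop) : {ae mu, forall x, P x} ->
  {ae mu, forall x, P (phi x)}.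
Proof.
move=> [N [mN N0 PN]]; exists (phi @^-1` N); split.
- by rewrite -[X in measurable X]setTI; exact: mphi.
- by rewrite phi_mu.
- by move=> x /= nP; apply: PN.
Qed.

Definition L2comp (v : L2space mu) : L2space mu := L2class mu (v \o phi).

Lemma L2comp_class f : L2 mu setT f ->
  L2comp (L2class mu f) = L2class mu (f \o phi).
Proof.
move=> Lf; apply: eq_L2class.
- exact/L2_comp/L2fun_L2.
- exact: L2_comp.
- exact: (ae_comp (ae_L2class Lf)).
Qed.

Lemma L2compB (u v : L2space mu) : L2comp (u - v) = L2comp u - L2comp v.
Proof.
have Lu := L2fun_L2 u; have Lv := L2fun_L2 v.
rewrite -{1}[u]L2funK -{1}[v]L2funK -(L2classB Lu Lv).
rewrite (L2comp_class (L2_sub Lu Lv)).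
exact: (L2classB (L2_comp Lu) (L2_comp Lv)).
Qed.

Lemma L2compZ (k : R) (v : L2space mu) : L2comp (k *: v) = k *: L2comp v.
Proof.
have Lv := L2fun_L2 v.
rewrite -{1}[v]L2funK -(L2classZ k Lv) (L2comp_class (L2_scale _ Lv)).
exact: (L2classZ k (L2_comp Lv)).
Qed.

Lemma L2comp_norm (v : L2space mu) :
  hnorm (dot := @L2dot _ _ _ mu) (L2comp v) = hnorm (dot := @L2dot _ _ _ mu) v.
Proof.
have Lv := L2fun_L2 v; apply: EFin_inj.
rewrite -(L2norm_hnorm (L2_comp Lv)) (L2norm_comp (L2_cmeasurable Lv)).
by rewrite (L2norm_hnorm Lv) L2funK.
Qed.

End measure_preserving.

(** * Strongly continuous unitary groups acting on classes of functions *)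

Section L2_unitary_groups.
Context {R : realType} {disp : measure_display} {T : measurableType disp}.
Variable mu : {measure set T -> \bar R}.
Implicit Types (f g w : T -> R[i]) (u v : L2space mu).
Local Open Scope complex_scope.
Notation norm := (hnorm (dot := @L2dot _ _ _ mu)).

(* [unitary_group] with an arbitrary measure in place of [lebesgue R d]; for the
   latter the two are convertible *)
Definition L2_unitary_group (U : R -> (T -> R[i]) -> (T -> R[i])) : Prop :=
  [/\ forall t f, L2 mu setT f ->
        L2 mu setT (U t f) /\ L2norm mu setT (U t f) = L2norm mu setT f,
      forall t f g, L2 mu setT f -> L2 mu setT g ->
        {ae mu, forall x, f x = g x} -> {ae mu, forall x, U t f x = U t g x},
      forall t (c : R[i]) f g, L2 mu setT f -> L2 mu setT g ->
        {ae mu, forall x,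
           U t (fun y => c * f y + g y) x = c * U t f x + U t g x},
      forall f, L2 mu setT f ->
        {ae mu, forall x, U 0 f x = f x} /\
        forall t t', {ae mu, forall x, U (t + t') f x = U t (U t' f) x} &
      forall f, L2 mu setT f ->
        L2norm mu setT (U t f \- f) @[t --> 0] --> 0%E].

Variable U : R -> (T -> R[i]) -> (T -> R[i]).
Hypothesis HU : L2_unitary_group U.

Definition L2group (t : R) v : L2space mu := L2class mu (U t v).

Lemma unitary_L2 t f : L2 mu setT f -> L2 mu setT (U t f).
Proof. by case: HU => /(_ t f) + _ _ _ _ Lf => /(_ Lf)[]. Qed.

Lemma eq_ae_unitary t f g : L2 mu setT f -> L2 mu setT g ->
  {ae mu, forall x, f x = g x} -> {ae mu, forall x, U t f x = U t g x}.
Proof. by case: HU => _ + _ _ _; exact. Qed.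

Lemma L2group_class t f : L2 mu setT f ->
  L2group t (L2class mu f) = L2class mu (U t f).
Proof.
move=> Lf; apply: eq_L2class.
- exact/unitary_L2/L2fun_L2.
- exact: unitary_L2.
- exact: (eq_ae_unitary t (L2fun_L2 _) Lf (ae_L2class Lf)).
Qed.

Lemma L2group_linear t (k : R) u v :
  L2group t (k *: u + v) = k *: L2group t u + L2group t v.
Proof.
have Lu := L2fun_L2 u; have Lv := L2fun_L2 v.
have Luv : L2 mu setT (fun x => k%:C * u x + v x).
  exact: (L2_add (L2_scale k%:C Lu) Lv).
have [_ _ /(_ t k%:C _ _ Lu Lv) lin _ _] := HU.
have LUu := unitary_L2 t Lu; have LUv := unitary_L2 t Lv.
rewrite -{1}[u]L2funK -{1}[v]L2funK -(L2classZ k Lu).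
rewrite -(L2classD (L2_scale k%:C Lu) Lv) (L2group_class t Luv).
rewrite -(L2classZ k LUu) -(L2classD (L2_scale k%:C LUu) LUv).
exact: (eq_L2class (unitary_L2 t Luv) (L2_add (L2_scale k%:C LUu) LUv) lin).
Qed.

Lemma L2group_isometric : isometric_group (dot := @L2dot _ _ _ mu) L2group.
Proof.
have D t u v : L2group t (u + v) = L2group t u + L2group t v.
  by rewrite -[u]scale1r L2group_linear !scale1r.
have O t : L2group t 0 = 0.
  by apply: (addrI (L2group t 0)); rewrite -D !addr0.
split.
- exact: D.
- by move=> t k u; rewrite -[k *: u]addr0 L2group_linear O addr0.
- move=> t v; apply: EFin_inj; have Lv := L2fun_L2 v.
  rewrite -(L2norm_hnorm (unitary_L2 t Lv)); case: HU => /(_ t v Lv)[_ ->] _ _ _ _.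
  by rewrite (L2norm_hnorm Lv) L2funK.
- move=> v; have Lv := L2fun_L2 v; case: HU => _ _ _ /(_ v Lv)[E _] _.
  by rewrite -[RHS]L2funK; apply: eq_L2class E; [exact: unitary_L2|].
- move=> t t' v; have Lv := L2fun_L2 v; case: HU => _ _ _ /(_ v Lv)[_ E] _.
  rewrite [L2group t' v]/L2group (L2group_class t (unitary_L2 t' Lv)).
  apply: eq_L2class (E t t'); first exact: unitary_L2.
  exact/unitary_L2/unitary_L2.
- move=> v e e0; have Lv := L2fun_L2 v; case: HU => _ _ _ _ /(_ v Lv).
  have E t : L2norm mu setT (U t v \- v) = (norm (L2group t v - v))%:E.
    have LUv := unitary_L2 t Lv.
    have -> : L2norm mu setT (U t v \- v) =
        (norm (L2class mu (fun x => U t v x - v x)))%:E.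
      exact: (L2norm_hnorm (L2_sub LUv Lv)).
    by rewrite (L2classB LUv Lv) L2funK.
  rewrite (_ : (fun t => _) = (fun t => (norm (L2group t v - v))%:E)); last first.
    by apply/funext => t; rewrite E.
  move=> /fine_cvgP[_] /cvgrPdist_le/(_ _ e0) /nbhs_ballP[r /= r0 rP].
  exists (r / 2) => [|t tr]; first by rewrite divr_gt0.
  have tr' : `|t| < r.
    by rewrite (le_lt_trans tr)// ltr_pdivrMr// ltr_pMr// ltr1n.
  have := rP t; rewrite /ball/= !sub0r !normrN => /(_ tr').
  by rewrite ger0_norm ?hnorm_ge0.
Qed.

(** [is_exp_group] pairs [f] with g = Af. Taking g = iw there turns the term ig into -w, so w = -iAf
    is the derivative of the orbit of [f] at 0. *)
Lemma generates_exp f w : L2 mu setT f -> L2 mu setT w ->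
  generates (dot := @L2dot _ _ _ mu) L2group (L2class mu f) (L2class mu w) <->
  L2norm mu setT (fun x => (h^-1)%:C * (U h f x - f x) + (0 +i* 1) *
    ((0 +i* 1) * w x)) @[h --> 0^'] --> 0%E.
Proof.
move=> Lf Lw.
pose D (h : R) := L2group h (L2class mu f) - L2class mu f - h *: L2class mu w.
have E (h : R) : h != 0 ->
    L2norm mu setT (fun x => (h^-1)%:C * (U h f x - f x) + (0 +i* 1) *
    ((0 +i* 1) * w x)) = (`|h|^-1 * norm (D h))%:E.
  move=> h0; have LUf := unitary_L2 h Lf.
  have LD : L2 mu setT (fun x => (U h f x - f x) - h%:C * w x).
    exact: (L2_sub (L2_sub LUf Lf) (L2_scale _ Lw)).
  rewrite (_ : (fun x => _) =
      (fun x => (h^-1)%:C * ((U h f x - f x) - h%:C * w x))); last first.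
    apply/funext => x; rewrite [RHS]mulrBr !mulrA -rmorphM mulVf// rmorph1 mul1r.
    congr (_ + _).
    by apply/eqP; rewrite eq_complex !reimE /=; apply/andP; split; apply/eqP; ring.
  rewrite (L2norm_hnorm (L2_scale _ LD)) (L2classZ h^-1 LD) -normfV.
  rewrite -(hnormZ (L2dotP mu)); congr (EFin (norm (_ *: _))).
  rewrite (L2classB (L2_sub LUf Lf) (L2_scale _ Lw)) (L2classB LUf Lf).
  by rewrite (L2classZ h Lw) /D (L2group_class h Lf).
split=> [gen|].
  apply: (@cvg_trans _ ((`|h|^-1 * norm (D h))%:E @[h --> 0^'])).
    apply: near_eq_cvg; apply/nbhs_ballP; exists 1 => //= h _ h0.
    by rewrite E.
  apply: cvg_EFin; first exact: nearW.
  apply/cvgrPdist_le => e e0; have [r r0 rP] := gen e e0.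
  apply/nbhs_ballP; exists r => //= h; rewrite /ball/= sub0r normrN => hr h0.
  rewrite sub0r normrN ger0_norm ?mulr_ge0 ?invr_ge0 ?hnorm_ge0//.
  by rewrite mulrC ler_pdivrMr ?normr_gt0// rP// ltW.
move=> cv e e0.
have {}cv : (`|h|^-1 * norm (D h))%:E @[h --> 0^'] --> 0%E.
  apply: cvg_trans cv.
  apply: near_eq_cvg; apply/nbhs_ballP; exists 1 => //= h _ h0.
  by rewrite E.
move/fine_cvgP: cv => [_] /cvgrPdist_le/(_ _ e0) /nbhs_ballP[r /= r0 rP].
exists (r / 2) => [|h h0 hr]; first by rewrite divr_gt0.
have hr' : `|h| < r.
  by rewrite (le_lt_trans hr)// ltr_pdivrMr// ltr_pMr// ltr1n.
have := rP h; rewrite /ball/= !sub0r !normrN => /(_ hr' h0).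
rewrite ger0_norm ?mulr_ge0 ?invr_ge0 ?hnorm_ge0//.
by rewrite mulrC ler_pdivrMr ?normr_gt0.
Qed.

End L2_unitary_groups.

(** * Translation invariance of the Lebesgue measure *)

Section lebesgue_translation.
Context {R : realType}.
Local Open Scope ereal_scope.

Lemma measurable_addr (a : R) :
  measurable_fun setT ((fun x => a + x)%R : measurableTypeR R -> measurableTypeR R).
Proof. by apply: measurable_funD; [exact: measurable_cst|exact: measurable_id]. Qed.

(** The image measure agrees with the Lebesgue measure on half-open intervals, which determine
    it. *)
Lemma lebesgue_measure_addr (a : R) (A : set (measurableTypeR R)) : measurable A ->
  @lebesgue_measure R ((fun x => a + x)%R @^-1` A) = @lebesgue_measure R A.
Proof.
move=> mA; have mf := measurable_addr a.
pose nu := measure_function_pushforward__canonical__measure_function_Measure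
  (@lebesgue_measure R) mf.
rewrite -[LHS]/(nu A); apply/esym/lebesgue_measure_unique => //= _ [[b c]] _ <-.
rewrite /nu/= /pushforward.
rewrite (_ : _ @^-1` _ = `](b - a)%R, (c - a)%R]%classic); last first.
  by apply/seteqP; split => x /=; rewrite !in_itv/= ltrBlDl lerBrDl.
rewrite !lebesgue_measure_itv/= !lte_fin ltrD2r.
by case: ifPn => // _; rewrite -!EFinB; congr EFin; ring.
Qed.

Lemma ge0_integral_addr (a : R) (f : measurableTypeR R -> \bar R) :
  measurable_fun setT f -> (forall x, 0 <= f x) ->
  \int[@lebesgue_measure R]_x f (a + x)%R = \int[@lebesgue_measure R]_x f x.
Proof.
move=> mf f0; have ma := measurable_addr a.
have := @ge0_integral_pushforward _ _ _ _ _ _ ma (@lebesgue_measure R) setT f.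
rewrite preimage_setT => <- //.
by apply: eq_measure_integral => A mA _; exact: lebesgue_measure_addr.
Qed.

Lemma measurable_translate_borel n (a : n.-tuple (measurableTypeR R)) :
  measurable_fun setT (fun y : n.-tuple (measurableTypeR R) =>
    [tuple tnth a i + tnth y i | i < n]%R : n.-tuple (measurableTypeR R)).
Proof.
apply/measurable_fun_tnthP => i; rewrite (_ : _ \o _ = fun y => tnth a i + tnth y i)%R.
  by apply: measurable_funD; [exact: measurable_cst|exact: measurable_tnth].
by apply/funext => y /=; rewrite tnth_mktuple.
Qed.

(** Induction through sections: the section at [x] of the preimage of [A] is the section of [A] at
    a_0 + x, pulled back by the remaining coordinates of [a]. The first coordinate is then absorbed
    by the invariance of the outer integral. *)
Lemma borel_lebesgue_translate n (a : n.-tuple (measurableTypeR R))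
    (A : set (n.-tuple (measurableTypeR R))) : measurable A ->
  borel_lebesgue R n ((fun y => [tuple tnth a i + tnth y i | i < n]%R) @^-1` A) =
  borel_lebesgue R n A.
Proof.
elim: n a A => [|n IH] a A mA.
  congr (borel_lebesgue R 0 _); apply/seteqP.
  by split => y /=; rewrite [X in A X -> _]tuple0 [X in _ -> A X]tuple0.
rewrite /= /lebesgue_step /pushforward /product_measure1.
set m := borel_lebesgue R n.
set B := tuple_cons (T:=measurableTypeR R) (n:=n) @^-1` A.
have mB : measurable B.
  by rewrite -[B]setTI; exact: measurable_tuple_cons.
rewrite -(ge0_integral_addr (thead a) (f := m \o xsection B)); last 2 first.
- exact: measurable_fun_xsection.
- by move=> x; exact: measure_ge0.
apply: eq_integral => x _ /=.
rewrite -[RHS](IH [tuple of behead a]); last exact: measurable_xsection.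
congr (m _); apply/funext => t; rewrite /xsection/= propeqE !inE /B /=.
suff -> : [tuple (tnth a i + tnth (tuple_cons (x, t)) i)%R | i < n.+1] =
    tuple_cons ((thead a + x)%R,
      [tuple (tnth [tuple of behead a] i + tnth t i)%R | i < n]) by [].
apply: eq_from_tnth => i; rewrite tnth_mktuple [in LHS](tuple_eta a).
case: (unliftP ord0 i) => [j ->|->]; last by rewrite !tnth0.
by rewrite !tnthS tnth_mktuple.
Qed.

(** [cube] seen as a Borel set of tuples, where its measure can be computed as a product. *)
Definition box n (a : n.-tuple (measurableTypeR R)) (l : R) :
    set (n.-tuple (measurableTypeR R)) :=
  [set x | forall i, (tnth a i <= tnth x i <= tnth a i + l)%R].

Lemma measurable_box n (a : n.-tuple (measurableTypeR R)) (l : R) :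
  measurable (box a l).
Proof.
rewrite (_ : box a l = \bigcap_(i in [set: 'I_n])
    ((fun x => tnth x i) @^-1` `[tnth a i, (tnth a i + l)%R]%classic)).
  apply: fin_bigcap_measurable => //.
  by move=> i _; rewrite -[X in measurable X]setTI; exact: measurable_tnth.
apply/seteqP; split => [x bx i _|x bx i]; first by rewrite /= in_itv/= bx.
by have := bx i I; rewrite /= in_itv.
Qed.

Lemma borel_lebesgue_box n (a : n.-tuple (measurableTypeR R)) (l : R) :
  (0 <= l)%R -> borel_lebesgue R n (box a l) = (l ^+ n)%:E.
Proof.
move=> l0; elim: n a => [|n IH] a.
  rewrite (_ : box a l = setT); first by rewrite /= diracT expr0.
  by apply/seteqP; split => // x _ [].
rewrite /= /lebesgue_step /pushforward.
rewrite (_ : _ @^-1` _ =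
    `[thead a, (thead a + l)%R]%classic `*` box [tuple of behead a] l).
  rewrite product_measure1E//; last exact: measurable_box.
  rewrite IH /= lebesgue_measure_itv/= lte_fin ltrDl -EFinB [X in (X%:E)]addrC addKr.
  case: ltP => [_|l0']; first by rewrite -EFinM exprS.
  by rewrite (@le_anti _ R l 0%R) ?l0 ?l0'// mul0e exprS mul0r.
apply/seteqP; split => [[x t] /= H|[x t] /= [H1 H2] i].
  split => [|i]; first by have := H ord0; rewrite in_itv /= !tnth0.
  by have := H (lift ord0 i); rewrite [in X in X -> _](tuple_eta a) !tnthS.
rewrite [in X in is_true X](tuple_eta a).
case: (unliftP ord0 i) => [j ->|->]; last by rewrite !tnth0.
by rewrite !tnthS; exact: H2.
Qed.

End lebesgue_translation.

(** * Translations of the completed measure on R^d *)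

Section euclidean_translation.
Context {R : realType} {d : nat}.
Notation Rd := (euclidean R d).
Notation leb := (lebesgue R d).
Implicit Types (x y : Rd) (A X : set Rd).
Local Open Scope ereal_scope.

Definition negv x : Rd := [tuple (- coord x i)%R | i < d].

Lemma coord_translate x y i : coord (translate x y) i = (coord x i + coord y i)%R.
Proof. by rewrite /coord tnth_mktuple. Qed.

Lemma coord_negv x i : coord (negv x) i = (- coord x i)%R.
Proof. by rewrite /coord tnth_mktuple. Qed.

Lemma translateC x y : translate x y = translate y x.
Proof.
by apply: eq_from_tnth => i; rewrite -!/(coord _ _) !coord_translate addrC.
Qed.

Lemma translateK x : cancel (translate x) (translate (negv x)).
Proof.
move=> y; apply: eq_from_tnth => i.
by rewrite -!/(coord _ _) !coord_translate coord_negv addrA addNr add0r.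
Qed.

Lemma translateNK x : cancel (translate (negv x)) (translate x).
Proof.
move=> y; apply: eq_from_tnth => i.
by rewrite -!/(coord _ _) !coord_translate coord_negv addrA addrN add0r.
Qed.

Let mu_ext_le x X :
  (borel_lebesgue R d)^*%mu (translate x @^-1` X) <= (borel_lebesgue R d)^*%mu X.
Proof.
apply: ereal_inf_le_tmp => _ [F [mF XF]] <-.
exists (fun k => translate x @^-1` F k); first split.
- move=> k; rewrite -[X in measurable X]setTI.
  exact: (measurable_translate_borel x).
- by move=> y Xy; have [k _ Fk] := XF _ Xy; exists k.
- by apply: eq_eseriesr => k _; apply: borel_lebesgue_translate.
Qed.

Lemma lebesgue_translate x X : leb (translate x @^-1` X) = leb X.
Proof.
apply/eqP; rewrite eq_le mu_ext_le /=.
have := mu_ext_le (negv x) (translate x @^-1` X).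
by rewrite -comp_preimage (_ : translate x \o _ = id)//; exact/funext/translateNK.
Qed.

Lemma measurable_lebesgueP A : measurable A <->
  forall X, leb X = leb (X `&` A) + leb (X `&` ~` A).
Proof. by []. Qed.

(** The criterion for the preimage of [A], tested on [X], is the criterion for [A] tested on a
    translate of [X]. *)
Lemma measurable_translate x : measurable_fun setT (translate x : Rd -> Rd).
Proof.
move=> _ A /measurable_lebesgueP mA; rewrite setTI.
apply/measurable_lebesgueP => X; rewrite -(lebesgue_translate (negv x) X) mA.
rewrite -[in RHS](lebesgue_translate (negv x) (X `&` _)).
rewrite -[in RHS](lebesgue_translate (negv x) (X `&` ~` _)).
by congr (_ + _); congr (leb _); apply/seteqP; split => y /=; rewrite translateNK.
Qed.

Lemma lebesgue_borel (A : set (d.-tuple (measurableTypeR R))) : measurable A ->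
  leb A = borel_lebesgue R d A.
Proof. exact: measurable_mu_extE. Qed.

Lemma measurable_borel (A : set (d.-tuple (measurableTypeR R))) : measurable A ->
  measurable (A : set Rd).
Proof. by move=> mA; apply: sub_caratheodory; exact: sub_sigma_algebra. Qed.

Lemma measurable_coord i : measurable_fun setT (fun x : Rd => coord x i).
Proof. by move=> _ A mA; apply: measurable_borel; exact: measurable_tnth. Qed.

Lemma measurable_cube x (l : R) : measurable (cube x l : set Rd).
Proof. exact: (measurable_borel (measurable_box x l)). Qed.

Lemma lebesgue_cube x (l : R) : (0 <= l)%R -> leb (cube x l) = (l ^+ d)%:E.
Proof.
move=> l0; rewrite -(borel_lebesgue_box x l0).
exact: (lebesgue_borel (measurable_box x l)).
Qed.

End euclidean_translation.

(** * Translations and the Fourier transform *)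

Section fourier_translation.
Context {R : realType} {d : nat}.
Notation Rd := (euclidean R d).
Notation leb := (lebesgue R d).
Implicit Types (f g : Rd -> R[i]) (a x xi : Rd).
Local Open Scope complex_scope.

Definition shift a f : Rd -> R[i] := fun x => f (translate a x).

Let lebesgue_translate_measurable a A : measurable A ->
  leb (translate a @^-1` A) = leb A.
Proof. by move=> _; exact: lebesgue_translate. Qed.

Lemma L2norm_shift a f : cmeasurable setT f ->
  L2norm leb setT (shift a f) = L2norm leb setT f.
Proof.
exact: (L2norm_comp (measurable_translate a) (@lebesgue_translate_measurable a)).
Qed.

Lemma L2_shift a f : L2 leb setT f -> L2 leb setT (shift a f).
Proof.
exact: (L2_comp (measurable_translate a) (@lebesgue_translate_measurable a)).
Qed.

Lemma L1_shift a f : L1 leb setT f -> L1 leb setT (shift a f).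
Proof.
exact: (L1_comp (measurable_translate a) (@lebesgue_translate_measurable a)).
Qed.

Lemma dotp_translate a x xi : dotp (translate a x) xi = dotp a xi + dotp x xi.
Proof.
rewrite /dotp -big_split/=; apply: eq_bigr => i _.
by rewrite coord_translate mulrDl.
Qed.

Lemma measurable_dotp xi : measurable_fun setT (fun x : Rd => dotp x xi).
Proof.
apply: measurable_sum => i; apply: measurable_funM.
  exact: measurable_coord.
exact: measurable_cst.
Qed.

Lemma dotpC x xi : dotp x xi = dotp xi x.
Proof. by apply: eq_bigr => i _; rewrite mulrC. Qed.

Lemma cexpiD (s t : R) : cexpi (s + t) = cexpi s * cexpi t.
Proof.
by apply/eqP; rewrite eq_complex !reimE /= cosD sinD !eqxx/= addrC mulrC;
  apply/eqP; congr (_ + _); rewrite mulrC.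
Qed.

Lemma cmeasurable_cexpi (h : Rd -> R) : measurable_fun setT h ->
  cmeasurable setT (fun x => cexpi (h x)).
Proof.
move=> mh; split.
  apply: measurableT_comp mh; apply: continuous_measurable_fun.
  exact: continuous_cos.
apply: measurableT_comp mh; apply: continuous_measurable_fun.
exact: continuous_sin.
Qed.

Lemma L1_re f : L1 leb setT f ->
  leb.-integrable setT (EFin \o (fun x => complex.Re (f x))).
Proof.
move=> [[f1 f2] fy]; have mf : cmeasurable setT f by [].
apply: (le_integrable measurableT (g := fun x => (cmod (f x))%:E)).
- exact/measurable_EFinP.
- move=> x _ /=; rewrite lee_fin (ger0_norm (cmod_ge0 _)) -sqrtr_sqr.
  by rewrite ler_sqrt ?addr_ge0 ?sqr_ge0// lerDl sqr_ge0.
- apply/integrableP; split; first by apply/measurable_EFinP/measurable_cmod.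
  by under eq_integral do rewrite gee0_abs ?lee_fin ?cmod_ge0//.
Qed.

Lemma L1_im f : L1 leb setT f ->
  leb.-integrable setT (EFin \o (fun x => complex.Im (f x))).
Proof.
move=> [[f1 f2] fy]; have mf : cmeasurable setT f by [].
apply: (le_integrable measurableT (g := fun x => (cmod (f x))%:E)).
- exact/measurable_EFinP.
- move=> x _ /=; rewrite lee_fin (ger0_norm (cmod_ge0 _)) -sqrtr_sqr.
  by rewrite ler_sqrt ?addr_ge0 ?sqr_ge0// lerDr sqr_ge0.
- apply/integrableP; split; first by apply/measurable_EFinP/measurable_cmod.
  by under eq_integral do rewrite gee0_abs ?lee_fin ?cmod_ge0//.
Qed.

Lemma cintegralZ (c : R[i]) f : L1 leb setT f ->
  cintegral leb setT (fun x => c * f x) = c * cintegral leb setT f.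
Proof.
move=> Lf; have i1 := L1_re Lf; have i2 := L1_im Lf.
have iZ (k : R) (h : Rd -> R) : leb.-integrable setT (EFin \o h) ->
    leb.-integrable setT (EFin \o (fun x => k * h x)).
  by move=> /(integrableZl measurableT k); apply: eq_integrable.
apply/eqP; rewrite eq_complex !reimE /=; apply/andP; split; apply/eqP.
  rewrite -!RintegralZl// -RintegralB//; try exact: iZ.
  by apply: eq_Rintegral => x _; rewrite reM.
rewrite -!RintegralZl// -RintegralD//; try exact: iZ.
by apply: eq_Rintegral => x _; rewrite imM.
Qed.

Lemma cintegral_shift a f : cmeasurable setT f ->
  cintegral leb setT (shift a f) = cintegral leb setT f.
Proof.
move=> [f1 f2]; congr Complex; congr fine.
  exact: (integral_comp (measurable_translate a) (@lebesgue_translate_measurable a)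
    (proj2 (measurable_EFinP _ _) f1)).
exact: (integral_comp (measurable_translate a) (@lebesgue_translate_measurable a)
  (proj2 (measurable_EFinP _ _) f2)).
Qed.

(** Since e^{-i x.xi} = e^{i a.xi} e^{-i (a + x).xi}, the integrand is a phase constant in x times
    the translate of the integrand for [f]. *)
Lemma fourier_integral_shift a f xi : L1 leb setT f ->
  fourier_integral (shift a f) xi = cexpi (dotp a xi) * fourier_integral f xi.
Proof.
move=> [mf fy]; rewrite /fourier_integral.
pose h x := cexpi (- dotp x xi) * f x.
have mh : cmeasurable setT h.
  apply: (cmeasurableM _ mf); apply: cmeasurable_cexpi.
  exact/measurable_funN/measurable_dotp.
have Lh : L1 leb setT h.
  by split => //; under eq_integral do rewrite cmodM cmod_cexpi mul1r.
rewrite -[in RHS]/(h _) -(cintegral_shift a mh) -cintegralZ; last exact: L1_shift.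
congr cintegral; apply/funext => x; rewrite /shift /h mulrA -cexpiD.
by rewrite dotp_translate opprD addrA addrN add0r.
Qed.

(** The approximating sequence is translated along with [f]. Neither translations nor phases change
    L2 norms, so both sequences of distances stay the same. *)
Lemma is_fourier_shift a f fhat : is_fourier f fhat ->
  is_fourier (shift a f) (fun xi => cexpi (dotp a xi) * fhat xi).
Proof.
move=> [Lf Lfh [F LF [Ff Fh]]].
have mphase : cmeasurable setT (fun xi => cexpi (dotp a xi)).
  apply: cmeasurable_cexpi; rewrite (_ : dotp a = dotp ^~ a).
    exact: measurable_dotp.
  by apply/funext => xi; rewrite dotpC.
split; first exact: L2_shift.
  apply: (le_L2 _ _ Lfh) => [|x]; last by rewrite cmodM cmod_cexpi mul1r.
  exact: (cmeasurableM mphase (L2_cmeasurable Lfh)).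
exists (fun n => shift a (F n)).
  by move=> n; split; [apply: L1_shift|apply: L2_shift]; case: (LF n).
split.
  have E : (fun n => L2norm leb setT (shift a (F n) \- shift a f)) =
      (fun n => L2norm leb setT (F n \- f)).
    apply/funext => n.
    exact: (@L2norm_shift a (F n \- f) (L2_cmeasurable (L2_sub (LF n).2 Lf))).
  by rewrite E.
have E : (fun n => L2norm leb setT (fourier_integral (shift a (F n)) \-
      (fun xi => cexpi (dotp a xi) * fhat xi))) =
    (fun n => L2norm leb setT (fourier_integral (F n) \- fhat)).
  apply/funext => n; rewrite /L2norm; congr sqrte; apply: eq_integral => xi _.
  rewrite /= fourier_integral_shift; last exact: (LF n).1.
  by rewrite -mulrBr cmodM cmod_cexpi mul1r.
by rewrite E.
Qed.

Lemma fourier_multiplier_shift a m f g : fourier_multiplier m f g ->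
  fourier_multiplier m (shift a f) (shift a g).
Proof.
move=> [fh [gh [ffh ggh fg]]].
exists (fun xi => cexpi (dotp a xi) * fh xi).
exists (fun xi => cexpi (dotp a xi) * gh xi).
split; [exact: is_fourier_shift|exact: is_fourier_shift|].
by apply: filterS fg => xi ->; rewrite mulrCA.
Qed.

End fourier_translation.

(** * Orbits of unitary groups *)

Section translation_invariant_orbits.
Context {R : realType} {disp : measure_display} {T : measurableType disp}.
Variable mu : {measure set T -> \bar R}.
Local Open Scope complex_scope.
Notation norm := (hnorm (dot := @L2dot _ _ _ mu)).
Implicit Types f g : T -> R[i].

Variables (U : R -> (T -> R[i]) -> (T -> R[i])).
Hypothesis HU : L2_unitary_group mu U.

(** [A] enters only through its relation to the group: if it is invariant under the maps [phi i], so
    is the generator. One vector of the domain serves all [i] and [t] at once, while [v0] itself may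
    lie outside the domain. *)
Lemma commuting_orbit_ex (I : Type) (phi : I -> T -> T)
    (A : (T -> R[i]) -> (T -> R[i]) -> Prop) (v0 : L2space mu) :
  (forall i, measurable_fun setT (phi i)) ->
  (forall i B, measurable B -> mu (phi i @^-1` B) = mu B) ->
  (forall i f g, A f g -> A (f \o phi i) (g \o phi i)) ->
  (forall f g, A f g <-> [/\ L2 mu setT f, L2 mu setT g &
     L2norm mu setT
       (fun x => (h^-1)%:C * (U h f x - f x) + (0 +i* 1) * g x)
       @[h --> 0^'] --> 0%E]) ->
  v0 != 0 ->
  exists g, [/\ L2 mu setT g, 0 < fdot mu g g &
    forall i t, {ae mu, forall x, U t (g \o phi i) x = U t g (phi i x)}].
Proof.
move=> mphi phi_mu Aphi AU v00.
have ip := L2dotP mu; have IG := L2group_isometric HU.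
have [v [w [vn0 gen]]] := generates_ex ip IG (@L2space_complete _ _ _ mu) v00.
have Lv := L2fun_L2 v; exists v; split => //.
  rewrite lt_neqAle fdot_ge0 andbT eq_sym; apply: contra_neq vn0.
  exact: (dot_eq0 ip).
move=> i t.
have Lvi := L2_comp (mphi i) (phi_mu i) Lv.
have LUvi := L2_comp (mphi i) (phi_mu i) (unitary_L2 HU t Lv).
have invariant (y z : L2space mu) :
    generates (dot := @L2dot _ _ _ mu) (L2group (mu := mu) U) y z ->
    generates (dot := @L2dot _ _ _ mu) (L2group (mu := mu) U)
      (L2comp (phi i) y) (L2comp (phi i) z).
  have Ly := L2fun_L2 y; have Lz := L2fun_L2 z.
  rewrite -{1}[y]L2funK -{1}[z]L2funK => /(generates_exp HU Ly Lz) H.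
  (* A generator pair satisfies z = -iAy, hence Ay = iz. *)
  have : A y (fun x => (0 +i* 1) * z x) by apply/AU; split => //; exact: L2_scale.
  move=> /(Aphi i)/AU[_ _ H'].
  exact: (proj2 (generates_exp HU (L2_comp (mphi i) (phi_mu i) Ly)
    (L2_comp (mphi i) (phi_mu i) Lz)) H').
have := commute_generator ip IG (L2compB (mphi i) (phi_mu i))
  (L2compZ (mphi i) (phi_mu i)) (L2comp_norm (mphi i) (phi_mu i)) invariant gen t.
rewrite /L2comp (L2group_class HU t Lvi).
rewrite -[RHS]/(L2comp (phi i) (L2class mu (U t v))).
rewrite (L2comp_class (mphi i) (phi_mu i) (unitary_L2 HU t Lv)) => E.
apply: filterS2 (ae_L2class (unitary_L2 HU t Lvi)) (ae_L2class LUvi) => x.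
by rewrite E => <- ->.
Qed.

Variable K : nat -> set T.
Hypothesis mK : forall n, measurable (K n).
Hypothesis ndK : forall n m, (n <= m)%N -> K n `<=` K m.
Hypothesis coverK : forall x, exists n, K n x.

(* the integral of |f|^2 over the complement of [K n `&` {|f|^2 <= n}] tends
   to 0 *)
Lemma L2_concentrated f (e : R) : L2 mu setT f -> 0 < e ->
  exists n, exists2 b : R, 0 < b & forall E, measurable E ->
    (mu (E `&` K n) <= b%:E)%E ->
    (\int[mu]_x (\1_E x * cmod (f x) ^+ 2)%:E <= e%:E)%E.
Proof.
move=> Lf e0; have mf := L2_cmeasurable Lf; have e2 : 0 < e / 2 by rewrite divr_gt0.
pose B n := K n `&` [set x | cmod (f x) ^+ 2 <= n%:R].
have mB n : measurable (B n).
  apply: measurableI => //; rewrite -[X in measurable X]setTI.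
  rewrite (_ : [set x | _] = (fun x => cmod (f x) ^+ 2) @^-1` `]-oo, n%:R]%classic).
    by apply: (measurable_funX 2 (measurable_cmod mf)) => //; exact: measurable_itv.
  by apply/seteqP; split => x /=; rewrite in_itv.
pose h n x : \bar R := (\1_(~` B n) x * cmod (f x) ^+ 2)%:E.
have mh n : measurable_fun setT (h n).
  apply/measurable_EFinP/measurable_funM; first exact/measurable_indic/measurableC.
  exact: measurable_funX (measurable_cmod mf).
have h0 n x : (0 <= h n x)%E.
  by rewrite lee_fin mulr_ge0 ?sqr_ge0// indicE; case: (_ \in _).
have cvgh : (\int[mu]_x h n x)%E @[n --> \oo] --> (\int[mu]_x (cst 0 x))%E.
  apply: (dominated_cvg measurableT _ _ _ (L2_integrable_sqr Lf)).
  - exact: mh.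
  - move=> x _; have [n Kn] := coverK x.
    (* From this index on [x] lies in [B m]: the exhaustion has reached it and m exceeds |f x|^2. *)
    apply: cvg_near_cst; exists (maxn n (Num.truncn (cmod (f x) ^+ 2)).+1) => // m.
    rewrite /= geq_max => /andP[nm fm]; rewrite /h indicE memNset ?mul0r// => nB.
    apply: nB; split; first exact: ndK nm _ Kn.
    by rewrite /= (le_trans (ltW (truncnS_gt _)))// ler_nat.
  - by [].
  - move=> n x _; rewrite gee0_abs// lee_fin indicE.
    by case: (_ \in _); rewrite ?mul1r ?mul0r ?sqr_ge0.
rewrite integral0 in cvgh.
have [n hn] : exists n, (\int[mu]_x h n x <= (e / 2)%:E)%E.
  move/fine_cvgP: cvgh => [[n1 _ f1] /cvgrPdist_le/(_ _ e2)[n2 _ f2]].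
  exists (maxn n1 n2); have := f1 _ (leq_maxl n1 n2) => /= fin.
  have := f2 _ (leq_maxr n1 n2) => /=; rewrite sub0r normrN ger0_norm; last first.
    by rewrite fine_ge0// integral_ge0.
  by rewrite -lee_fin fineK.
(* On the part of [E] inside [B n] the integrand is at most n <= n + 1, so this part contributes at
   most (n + 1) b = e / 2; the successor keeps [b] positive when n = 0. *)
exists n; exists (e / 2 / n.+1%:R); first by rewrite divr_gt0.
move=> E mE EK.
have mI : measurable_fun setT (fun x => (n.+1%:R * \1_(E `&` K n) x)%:E : \bar R).
  apply/measurable_EFinP/measurable_funM; first exact: measurable_cst.
  exact/measurable_indic/measurableI.
have I0 x : (0 <= (n.+1%:R * \1_(E `&` K n) x : R)%:E)%E.
  by rewrite lee_fin mulr_ge0// indicE.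
apply: (@le_trans _ _ (\int[mu]_x (h n x + (n.+1%:R * \1_(E `&` K n) x)%:E))%E).
  apply: ge0_le_integral => //.
  - by move=> x _; rewrite lee_fin mulr_ge0 ?sqr_ge0// indicE.
  - apply/measurable_EFinP/measurable_funM; first exact/measurable_indic.
    exact: measurable_funX (measurable_cmod mf).
  - exact: emeasurable_funD.
  - move=> x _; rewrite /h -EFinD lee_fin !indicE.
    have [Ex|_] := boolP (x \in E); last first.
      by rewrite mul0r addr_ge0// mulr_ge0// ?sqr_ge0.
    have [Bx|nBx] := boolP (x \in ~` B n).
      by rewrite !mul1r lerDl mulr_ge0.
    move: nBx; rewrite notin_setE /= => /contrapT[Kx /= fx].
    rewrite mul0r add0r mul1r mem_set ?mulr1/=; last by split => //; exact: set_mem.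
    by rewrite (le_trans fx)// ler_nat.
rewrite ge0_integralD// (_ : e%:E = (e / 2)%:E + (e / 2)%:E)%E; last first.
  by rewrite -EFinD; congr EFin; field.
rewrite leeD//; under eq_integral do rewrite EFinM.
rewrite ge0_integralZl_EFin//; last exact/measurable_EFinP/measurable_indic/measurableI.
rewrite integral_indic//; last exact: measurableI.
rewrite setIT (le_trans (lee_wpmul2l _ EK)) ?lee_fin//.
by rewrite mulrC divfK ?pnatr_eq0.
Qed.

(** Total boundedness is what is used of compactness: by strong continuity the finitely many vectors
    U (j r) g with |j| <= M form an e/2-net of the orbit. [L2_concentrated] handles each of them,
    and cutting off to [E] does not increase norms. *)
Lemma orbit_concentrated g (e S : R) : L2 mu setT g -> 0 < e ->
  exists n, exists2 b : R, 0 < b & forall t E, `|t| <= S -> measurable E ->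
    (mu (E `&` K n) <= b%:E)%E ->
    norm (L2class mu (fun x => \1_E x * U t g x)) <= e.
Proof.
move=> Lg e0; have ip := L2dotP mu; have IG := L2group_isometric HU.
have e2 : 0 < e / 2 by rewrite divr_gt0.
have [r r0 rP] := ig_cont IG (L2class mu g) e2.
have single f : L2 mu setT f ->
    exists n, exists2 b : R, 0 < b & forall E, measurable E ->
    (mu (E `&` K n) <= b%:E)%E ->
    norm (L2class mu (fun x => \1_E x * f x)) <= e / 2.
  move=> Lf; have [n [b b0 nb]] := L2_concentrated Lf (exprn_gt0 2 e2).
  exists n; exists b => // E mE EK; have L := L2_indic mE Lf.
  apply: ler_hnorm_sqr; first exact: ltW.
  rewrite -lee_fin -(L2class_norm_sqr L); apply: le_trans (nb E mE EK).
  rewrite le_eqVlt; apply/orP; left; apply/eqP.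
  apply: eq_integral => x _; rewrite cmodM exprMn !indicE; congr (EFin (_ * _)).
  by case: (_ \in _); rewrite ?cmod0 ?expr0n// /cmod/= expr0n
    expr1n addr0 sqrtr1 expr1n.
have restrict_le f E : measurable E -> L2 mu setT f ->
    norm (L2class mu (fun x => \1_E x * f x)) <= norm (L2class mu f).
  move=> mE Lf; apply: (L2class_norm_le (L2_indic mE Lf) Lf) => x; rewrite indicE.
  by case: (_ \in _); rewrite ?mul1r ?mul0r ?cmod0 ?cmod_ge0.
(* All times j r with |j| <= N share one pair, the largest [n] and the smallest [b]: a larger set
   [K n] and a smaller [b] restrict [E] more. *)
have family (N : nat) : exists n, exists2 b : R, 0 < b &
    forall (j : int) E, (`|j| <= N)%N -> measurable E ->
    (mu (E `&` K n) <= b%:E)%E ->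
    norm (L2class mu (fun x => \1_E x * U (j%:~R * r) g x)) <= e / 2.
  elim: N => [|N [n [b b0 nb]]].
    have [n [b b0 nb]] := single _ (unitary_L2 HU (0%:~R * r) Lg).
    exists n; exists b => // j E; rewrite leqn0 absz_eq0 => /eqP ->.
    exact: nb.
  have [n1 [b1 b10 nb1]] := single _ (unitary_L2 HU (N.+1%:Z%:~R * r) Lg).
  have [n2 [b2 b20 nb2]] := single _ (unitary_L2 HU ((- N.+1%:Z)%:~R * r) Lg).
  exists (maxn n (maxn n1 n2)); exists (Num.min b (Num.min b1 b2)).
    by rewrite !lt_min b0 b10.
  move=> j E jN mE Eb.
  have sub m c : (m <= maxn n (maxn n1 n2))%N -> Num.min b (Num.min b1 b2) <= c ->
      (mu (E `&` K m) <= c%:E)%E.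
    move=> mn cb; rewrite (@le_trans _ _ (Num.min b (Num.min b1 b2))%:E) ?lee_fin//.
    apply: le_trans Eb; apply: le_measure; rewrite ?inE; try exact: measurableI.
    by apply: setIS; exact: ndK.
  have [jN'|jN'] := leqP `|j| N.
    by apply: nb => //; apply: sub; [rewrite leq_max leqnn|rewrite ge_min lexx].
  have {}jN : `|j|%N = N.+1 by apply/eqP; rewrite eqn_leq jN.
  case: (intP j) jN => [//|k [->]|k]; last rewrite abszN => -[->].
    apply: nb1 => //; apply: sub; first by rewrite !leq_max leqnn orbT.
    by rewrite !ge_min lexx orbT.
  apply: nb2 => //; apply: sub; first by rewrite !leq_max leqnn !orbT.
  by rewrite !ge_min lexx !orbT.
have [n [b b0 nb]] := family (Num.truncn (S / r)).+1.
exists n; exists b => // t E tS mE EK.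
(* j r is the node at or before [t], at distance at most [r]. *)
pose j := Num.floor (t / r).
set M := (Num.truncn (S / r)).+1.
have /andP[j1 j2] := floor_itv (t / r).
have tM : `|t / r| <= M%:R.
  rewrite normrM normfV (gtr0_norm r0) (le_trans _ (ltW (truncnS_gt (S / r))))//.
  by rewrite ler_pM2r// invr_gt0.
have jN : (`|j| <= M)%N.
  move: tM; rewrite ler_norml => /andP[M1 M2].
  rewrite -lez_nat abszE ler_norml; apply/andP; split.
    by rewrite -ltzD1 -(ltr_int R) rmorphN /= (le_lt_trans M1 j2).
  by rewrite -(ler_int R) (le_trans j1 M2).
have jt : `|t - j%:~R * r| <= r.
  rewrite ger0_norm ?subr_ge0 -?ler_pdivlMr//.
  by rewrite lerBlDl -[X in _ + X]mul1r -mulrDl -ler_pdivrMr// ltW// -intrD1.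
have Lj := unitary_L2 HU (j%:~R * r) Lg; have Lt := unitary_L2 HU t Lg.
have L1' := L2_indic mE Lj; have L2' := L2_indic mE (L2_sub Lt Lj).
have -> : L2class mu (fun x => \1_E x * U t g x) =
    L2class mu (fun x => \1_E x * (U t g x - U (j%:~R * r) g x)) +
    L2class mu (fun x => \1_E x * U (j%:~R * r) g x).
  rewrite -L2classD//; congr L2class; apply/funext => x.
  by rewrite mulrBr subrK.
rewrite (le_trans (hnormD ip _ _))// (_ : e = e / 2 + e / 2); last by field.
rewrite lerD//; last exact: nb.
rewrite (le_trans (restrict_le _ _ mE (L2_sub Lt Lj)))// (L2classB Lt Lj).
rewrite -(L2group_class HU t Lg) -(L2group_class HU (j%:~R * r) Lg).
by rewrite (ig_norm_sub IG) rP.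
Qed.

End translation_invariant_orbits.

(** * Duality for the control problem *)

Section bochner_duality.
Context {R : realType} {disp : measure_display} {T : measurableType disp}.
Variable mu : {measure set T -> \bar R}.
Local Open Scope complex_scope.
Notation norm := (hnorm (dot := @L2dot _ _ _ mu)).
Notation lambda := (@lebesgue_measure R).
Implicit Types f g h : T -> R[i].

(* likewise for [is_bochner_integral] *)
Definition L2_bochner_integral (D : set R) (w : R -> T -> R[i])
    (v : T -> R[i]) : Prop :=
  L2 mu setT v /\
  exists (N : nat -> nat) (A : nat -> nat -> set R)
         (g : nat -> nat -> T -> R[i]),
    let dist n tau := L2norm mu setT
      (fun x => w tau x - \sum_(i < N n) \1_(A n i) tau * g n i x) in
    [/\ forall n i, measurable (A n i) /\ L2 mu setT (g n i),
        forall n, measurable_fun D (dist n),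
        (\int[lambda]_(tau in D) dist n tau)%E
          @[n --> \oo] --> 0%E &
        L2norm mu setT
          (fun x => \sum_(i < N n)
             (fine (lambda (D `&` A n i)))%:C * g n i x - v x)
          @[n --> \oo] --> 0%E].

Lemma L2_sum n (h : nat -> T -> R[i]) : (forall i, L2 mu setT (h i)) ->
  L2 mu setT (fun x => \sum_(i < n) h i x).
Proof.
move=> Lh; elim: n => [|n IH].
  by under eq_fun do rewrite big_ord0; exact: L2_cst0.
by under eq_fun do rewrite big_ord_recr/=; exact: L2_add.
Qed.

Lemma fdot_sum n (a : nat -> R) (h : nat -> T -> R[i]) g :
  (forall i, L2 mu setT (h i)) -> L2 mu setT g ->
  fdot mu (fun x => \sum_(i < n) (a i)%:C * h i x) g =
  \sum_(i < n) a i * fdot mu (h i) g.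
Proof.
move=> Lh Lg; elim: n => [|n IH].
  rewrite big_ord0 (_ : (fun _ => _) = (fun x => 0%:C * g x)).
    by rewrite fdotZl// mul0r.
  by apply/funext => x; rewrite big_ord0 rmorph0 mul0r.
rewrite (_ : (fun _ => _) =
    (fun x => \sum_(i < n) (a i)%:C * h i x + (a n)%:C * h n x)).
  rewrite fdotDl//; last exact: L2_scale.
    by rewrite IH fdotZl// big_ord_recr.
  by apply: (@L2_sum n (fun i x => (a i)%:C * h i x)) => i; exact: L2_scale.
by apply/funext => x; rewrite big_ord_recr.
Qed.

(** Used at both levels of the approximation: between the integrand and a simple function, and
    between the integral of that function and [v]. *)
Lemma fdot_le_dist f h g : L2 mu setT f -> L2 mu setT h -> L2 mu setT g ->
  (`|fdot mu h g|%:E <= L2norm mu setT (fun x => f x - h x)%R *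
     (norm (L2class mu g))%:E + `|fdot mu f g|%:E)%E.
Proof.
move=> Lf Lh Lg; have ip := L2dotP mu.
rewrite (L2norm_hnorm (L2_sub Lf Lh)) (L2classB Lf Lh) -EFinM -EFinD lee_fin.
rewrite -(L2dotE Lf Lg) -(L2dotE Lh Lg).
set F := L2class mu f; set H := L2class mu h; set G := L2class mu g.
have -> : L2dot H G = L2dot F G - L2dot (F - H) G.
  by rewrite (dotBl ip) opprB addrC subrK.
rewrite [leRHS]addrC (le_trans (ler_normB _ _))// lerD2l.
exact: cauchy_schwarz.
Qed.

(** For simple functions the pairing with [g] passes under the integral by linearity, and the two
    errors in the definition of the Bochner integral tend to 0. The measurable majorant [phi] is
    integrated in place of |<w tau, g>|, whose measurability is not among the hypotheses. *)
Lemma bochner_fdot_le (D : set R) (w : R -> T -> R[i]) (v : T -> R[i])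
    g (phi : R -> \bar R) :
  measurable D -> (lambda D < +oo)%E -> L2_bochner_integral D w v ->
  L2 mu setT g -> measurable_fun D phi -> (forall tau, 0 <= phi tau)%E ->
  {ae lambda, forall tau, D tau -> L2 mu setT (w tau) /\
    (`|fdot mu (w tau) g|%:E <= phi tau)%E} ->
  (`|fdot mu v g|%:E <= \int[lambda]_(tau in D) phi tau)%E.
Proof.
move=> mD Dfin [Lv [N [A [b [Ab mdist dist0 int0]]]]] Lg mphi phi0 wphi.
have mA n i : measurable (A n i : set (measurableTypeR R)) by case: (Ab n i).
have AD_fin n i : (lambda (D `&` A n i) < +oo)%E.
  apply: le_lt_trans Dfin; apply: le_measure; rewrite ?inE//.
  by apply: measurableI => //; exact: mA.
have Lb n i : L2 mu setT (b n i) by case: (Ab n i).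
set nG := norm (L2class mu g).
have nG0 : 0 <= nG by exact: hnorm_ge0.
pose q n tau := \sum_(i < N n) \1_(A n i) tau * fdot mu (b n i) g.
pose dist n tau := L2norm mu setT
  (fun x => w tau x - \sum_(i < N n) \1_(A n i) tau * b n i x).
pose V n x := \sum_(i < N n) (fine (lambda (D `&` A n i)))%:C * b n i x.
have dist_ge0 n tau : (0 <= dist n tau)%E by exact: sqrte_ge0.
have LV n : L2 mu setT (V n).
  apply: (@L2_sum (N n) (fun i x => (fine (lambda (D `&` A n i)))%:C * b n i x)).
  by move=> i; exact: L2_scale.
have indic_int n i : lambda.-integrable D (fun tau => (\1_(A n i) tau)%:E).
  apply/integrableP; split.
    by apply/measurable_EFinP; apply: measurable_indic; exact: mA.
  under eq_integral do rewrite gee0_abs ?lee_fin//.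
  rewrite integral_indic; [rewrite setIC; exact: AD_fin|exact: mD|exact: mA].
have intA n i : lambda.-integrable D
    (fun tau => (\1_(A n i) tau * fdot mu (b n i) g)%:E).
  under eq_fun do rewrite mulrC EFinM.
  by apply: integrableZl => //; exact: indic_int.
have fdotV n : (fdot mu (V n) g)%:E = (\int[lambda]_(tau in D) (q n tau)%:E)%E.
  rewrite /V (@fdot_sum (N n) (fun i => fine (lambda (D `&` A n i))) (b n))//.
  under eq_integral do rewrite /q -sumEFin.
  rewrite (@integral_sum _ _ _ lambda D mD _
    (fun (i : 'I_(N n)) tau => (\1_(A n i) tau * fdot mu (b n i) g)%:E)) -?sumEFin.
    apply: eq_bigr => i _; under eq_integral do rewrite mulrC EFinM.
    rewrite integralZl//.
    rewrite integral_indic; [rewrite setIC|exact: mD|exact: mA].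
    rewrite muleC EFinM; congr (_ * _)%E; rewrite fineK// ge0_fin_numE//.
    by rewrite setIC; exact: AD_fin.
  by move=> i; exact: intA.
have mq n : measurable_fun D (q n).
  apply: measurable_sum => i; apply: measurable_funM; last exact: measurable_cst.
  by apply: measurable_indic; exact: mA.
have q_le n : {ae lambda, forall tau, D tau ->
    (`|q n tau|%:E <= dist n tau * nG%:E + phi tau)%E}.
  case: wphi => Z [mZ Z0 ZP]; exists Z; split => // tau nq; apply: ZP => H.
  apply: nq => Dtau; have [Lw wg] := H Dtau.
  have E : (fun x => \sum_(i < N n) \1_(A n i) tau * b n i x) =
      (fun x => \sum_(i < N n) (\1_(A n i) tau : R)%:C * b n i x).
    apply/funext => x; apply: eq_bigr => i _; congr (_ * _).
    by rewrite !indicE; case: (_ \in _).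
  have LS : L2 mu setT (fun x => \sum_(i < N n) \1_(A n i) tau * b n i x).
    rewrite E.
    apply: (@L2_sum (N n) (fun i x => (\1_(A n i) tau : R)%:C * b n i x)).
    by move=> i; exact: L2_scale.
  have := fdot_le_dist Lw LS Lg.
  rewrite [in X in (X <= _)%E -> _]E.
  rewrite (@fdot_sum (N n) (fun i => \1_(A n i) tau) (b n))// => H2.
  by apply: le_trans H2 _; rewrite leeD2l.
have V_le n : (`|fdot mu (V n) g|%:E <=
    (\int[lambda]_(tau in D) dist n tau) * nG%:E +
    \int[lambda]_(tau in D) phi tau)%E.
  rewrite -abse_EFin fdotV.
  have mqE : measurable_fun D (fun tau => (q n tau)%:E) by exact/measurable_EFinP.
  apply: (le_trans (le_abse_integral lambda mD mqE)).
  have -> : ((\int[lambda]_(tau in D) dist n tau) * nG%:E +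
      \int[lambda]_(tau in D) phi tau =
      \int[lambda]_(tau in D) (dist n tau * nG%:E + phi tau))%E.
    rewrite ge0_integralD//; last 2 first.
    - by move=> tau _; rewrite mule_ge0// lee_fin.
    - by apply: emeasurable_funM => //; exact: mdist.
    by rewrite ge0_integralZr//; exact: mdist.
  apply: ae_ge0_le_integral => //.
  - by apply: measurableT_comp.
  - by move=> tau _; rewrite adde_ge0// mule_ge0// lee_fin.
  - apply: emeasurable_funD => //; apply: emeasurable_funM => //.
    exact: mdist.
  - exact: q_le.
have v_le n : (`|fdot mu v g|%:E <=
    L2norm mu setT (fun x => V n x - v x)%R * nG%:E +
    ((\int[lambda]_(tau in D) dist n tau) * nG%:E +
    \int[lambda]_(tau in D) phi tau))%E.
  exact: le_trans (fdot_le_dist (LV n) Lv Lg) (leeD2l _ (V_le n)).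
have [->|phi_fin] := eqVneq (\int[lambda]_(tau in D) phi tau)%E +oo%E.
  exact: leey.
have lim0 : (L2norm mu setT (fun x => V n x - v x)%R * nG%:E +
    ((\int[lambda]_(tau in D) dist n tau) * nG%:E +
    \int[lambda]_(tau in D) phi tau))%E @[n --> \oo] -->
    (0 * nG%:E + (0 * nG%:E + \int[lambda]_(tau in D) phi tau))%E.
  apply: cvgeD.
  - by rewrite !mul0e add0e.
  - by apply: cvgeZr => //; exact: int0.
  - apply: cvgeD; first by rewrite mul0e.
      by apply: cvgeZr => //; exact: dist0.
    exact: cvg_cst.
rewrite !mul0e !add0e in lim0.
rewrite -(cvg_lim _ lim0)//; apply: lime_ge; first by apply/cvg_ex; eexists; exact: lim0.
exact: nearW.
Qed.

End bochner_duality.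

(** * The bound that reachability imposes, and its clash with the gliding hump *)

Section exact_control.
Context {R : realType} {disp : measure_display} {T : measurableType disp}.
Variable mu : {sigma_finite_measure set T -> \bar R}.
Local Open Scope complex_scope.
Notation norm := (hnorm (dot := @L2dot _ _ _ mu)).
Notation lambda := (@lebesgue_measure R).
Implicit Types f g h : T -> R[i].

(** Tonelli's theorem for |u|^2, extended by 0 outside [D] because [u] is known to be measurable
    only there. Sections may fail to be square-integrable at a null set of times, hence an
    everywhere defined [F] to carry the squared norms. *)
Lemma L2_sections (D : set R) (u : R * T -> R[i]) : measurable D ->
  L2 (lambda \x mu)%E (D `*` setT) u ->
  exists F : R -> \bar R, [/\ measurable_fun setT F, forall tau, (0 <= F tau)%E,
    (\int[lambda]_(tau in D) F tau < +oo)%E &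
    {ae lambda, forall tau, D tau -> L2 mu setT (fun x => u (tau, x)) /\
      (\int[mu]_x (cmod (u (tau, x)) ^+ 2)%:E = F tau)%E}].
Proof.
move=> mD [[mre mim] uy].
have mDT : measurable (D `*` [set: T]) by exact: measurableX.
pose f := (fun p => (cmod (u p) ^+ 2)%:E) \_ (D `*` setT).
have mf : measurable_fun setT f.
  apply/(measurable_restrictT _ mDT).
  exact: (@measurable_cmod_sqr _ _ _ (D `*` setT) u (conj mre mim)).
have f0 p : (0 <= f p)%E.
  by rewrite /f /patch; case: ifPn => // _; rewrite lee_fin sqr_ge0.
have mF := @measurable_fun_fubini_tonelli_F _ _ _ _ _ mu f mf f0.
have F0 tau : (0 <= fubini_F mu f tau)%E by apply: integral_ge0.
have Ffin : (\int[lambda]_tau fubini_F mu f tau < +oo)%E.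
  rewrite -(@fubini_tonelli1 _ _ _ _ _ lambda mu f mf f0) /f -integral_mkcond.
  move: uy; rewrite /L2norm; case: (integral _ _ _) => //= r _.
  exact: ltry.
have sectionE tau x : D tau -> f (tau, x) = (cmod (u (tau, x)) ^+ 2)%:E.
  by move=> Dtau; rewrite /f patchE mem_set.
exists (fubini_F mu f); split => //.
  by apply: le_lt_trans Ffin; apply: ge0_subset_integral.
have /(integrable_ae measurableT) : lambda.-integrable setT (fubini_F mu f).
  apply/integrableP; split => //.
  by under eq_integral do rewrite gee0_abs//.
move=> [Z [mZ Z0 ZP]]; exists Z; split => // tau nq; apply: ZP => fin.
apply: nq => Dtau; have {}fin := fin I.
have E : (\int[mu]_x (cmod (u (tau, x)) ^+ 2)%:E = fubini_F mu f tau)%E.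
  by apply: eq_integral => x _; rewrite sectionE.
split => //; apply/L2P; split; last by rewrite E -ge0_fin_numE.
have [mre' mim'] := (proj1 (measurable_restrictT _ mDT) mre,
  proj1 (measurable_restrictT _ mDT) mim).
split.
  apply: (eq_measurable_fun (fun x =>
    ((fun p => complex.Re (u p)) \_ (D `*` setT)) (tau, x))).
    by move=> x _; rewrite patchE mem_set.
  exact: (measurableT_comp mre' (pair1_measurable tau)).
apply: (eq_measurable_fun (fun x =>
  ((fun p => complex.Im (u p)) \_ (D `*` setT)) (tau, x))).
  by move=> x _; rewrite patchE mem_set.
exact: (measurableT_comp mim' (pair1_measurable tau)).
Qed.

Lemma fdot_indic (omega : set T) f g :
  fdot mu (fun x => \1_omega x * f x) g = fdot mu f (fun x => \1_omega x * g x).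
Proof.
rewrite unlock; apply: eq_Rintegral => x _; rewrite indicE.
by case: (_ \in _); rewrite ?mul1r// !mul0r !mulr0.
Qed.

Variables (U : R -> (T -> R[i]) -> (T -> R[i])).
Hypothesis HU : L2_unitary_group mu U.

Lemma fdot_unitary t f g : L2 mu setT f -> L2 mu setT g ->
  fdot mu (U t f) g = fdot mu f (U (- t) g).
Proof.
move=> Lf Lg; have ip := L2dotP mu; have IG := L2group_isometric HU.
rewrite -(L2dotE (unitary_L2 HU t Lf) Lg) -(L2dotE Lf (unitary_L2 HU (- t) Lg)).
rewrite -(L2group_class HU t Lf) -(L2group_class HU (- t) Lg).
exact: (ig_adjoint ip IG).
Qed.

(** Duality: <U (S - t) (1_omega u(t)), g> = <u(t), 1_omega U (t - S) g>, which is at most e |u(t)|.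
    Bounding |u| by 1 + |u|^2 makes [M] the integral of 1 + [F], finite because the time interval is
    bounded. *)
Lemma control_bound (omega : set T) (S : R) (u : R * T -> R[i]) (v : T -> R[i]) :
  measurable omega -> 0 < S ->
  L2 (lambda \x mu)%E (`]0, S[ `*` setT) u ->
  L2_bochner_integral mu `]0, S[
    (fun tau => U (S - tau) (fun x => \1_omega x * u (tau, x))) v ->
  exists2 M : R, 0 <= M & forall g e, L2 mu setT g -> 0 <= e ->
    (forall t, `|t| <= S -> norm (L2class mu (fun x => \1_omega x * U t g x)) <= e) ->
    `|fdot mu v g| <= e * M.
Proof.
move=> mo S0 Lu Bv.
have mD : measurable (`]0, S[%classic : set (measurableTypeR R)).
  exact: measurable_itv.
have [F [mF F0 Ffin Fu]] := L2_sections mD Lu.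
have Dfin : (lambda `]0%R, S[%classic < +oo)%E.
  by rewrite lebesgue_measure_itv/= lte_fin S0 -EFinB ltry.
have int1F : (\int[lambda]_(tau in `]0%R, S[) (1 + F tau) < +oo)%E.
  rewrite ge0_integralD//; last exact: measurable_funTS.
  by rewrite integral_cst// mul1e lte_add_pinfty.
have int0 : (0 <= \int[lambda]_(tau in `]0%R, S[) (1 + F tau))%E.
  by apply: integral_ge0 => tau _; rewrite adde_ge0.
exists (fine (\int[lambda]_(tau in `]0%R, S[) (1 + F tau)%E)); first exact: fine_ge0.
move=> g e Lg e0 ge.
rewrite -lee_fin EFinM fineK ?ge0_fin_numE//.
rewrite -ge0_integralZl//; last 2 first.
- by apply: emeasurable_funD; [exact: measurable_cst|exact: measurable_funTS].
- by move=> tau _; rewrite adde_ge0.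
apply: (bochner_fdot_le mD Dfin Bv Lg).
- apply: measurable_funeM; apply: emeasurable_funD; first exact: measurable_cst.
  exact: measurable_funTS.
- by move=> tau; rewrite mule_ge0// adde_ge0.
case: Fu => Z [mZ Z0 ZP]; exists Z; split => // tau nq; apply: ZP => H.
apply: nq => Dtau; have [Lut Fut] := H Dtau.
have Lou := L2_indic mo Lut; have LUg := unitary_L2 HU (- (S - tau)) Lg.
have LoU := L2_indic mo LUg.
split; first exact: unitary_L2.
rewrite (fdot_unitary _ Lou Lg) fdot_indic -(L2dotE Lut LoU) -Fut.
rewrite (L2class_norm_sqr Lut) -EFinD -EFinM lee_fin.
rewrite (le_trans (cauchy_schwarz (L2dotP mu) _ _))//.
set a := norm _; set b := norm _.
have a0 : 0 <= a by exact: hnorm_ge0.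
have be : b <= e.
  apply: ge; rewrite normrN ger0_norm.
    by rewrite gerBl; move: Dtau; rewrite /= in_itv/= => /andP[/ltW].
  by rewrite subr_ge0; move: Dtau; rewrite /= in_itv/= => /andP[_ /ltW].
rewrite (le_trans (ler_wpM2l a0 be))// mulrC ler_wpM2l//.
have := sqr_ge0 (a - 1); nra.
Qed.

(** The hump gives |<x, G n>| >= c 3^-n / 2 for every n, while [control] gives at most M 3^-n / (n +
    1). The factor n + 1 is there to beat [M], which is known only after [x]. *)
Lemma gliding_hump_contra (omega : set T) (S c : R) (G : nat -> T -> R[i]) :
  0 < c ->
  (forall n, L2 mu setT (G n)) -> (forall n, norm (L2class mu (G n)) = c) ->
  (forall n t, `|t| <= S -> norm (L2class mu (fun x => \1_omega x * U t (G n) x)) <=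
     3^-1 ^+ n / n.+1%:R) ->
  ~ (forall v, L2 mu setT v -> exists2 M : R, 0 <= M & forall g e, L2 mu setT g ->
    0 <= e ->
    (forall t, `|t| <= S -> norm (L2class mu (fun x => \1_omega x * U t g x)) <= e) ->
    `|fdot mu v g| <= e * M).
Proof.
move=> c0 LG Gc Gsmall control; have ip := L2dotP mu.
have third_gt0 (n : nat) : 0 < (3^-1 : R) ^+ n by rewrite exprn_gt0// invr_gt0.
have [|x xG] := gliding_hump ip (@L2space_complete _ _ _ mu)
    (g := fun n => c^-1 *: L2class mu (G n)).
  by move=> n; rewrite (hnormZ ip) Gc ger0_norm ?invr_ge0 ?ltW// mulVf ?gt_eqF.
have Lx := L2fun_L2 x; have [M M0 xM] := control _ Lx.
(* Chosen so that n + 1 > 2 M / c, that is, M / (n + 1) < c / 2. *)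
pose n := Num.truncn (2 * M / c).
have e0 : 0 <= (3^-1 : R) ^+ n / n.+1%:R by rewrite divr_ge0// ltW.
have := xM _ _ (LG n) e0 (Gsmall n).
have := xG n; rewrite (dotZr ip) normrM -{1}[x]L2funK (L2dotE Lx (LG n)).
rewrite ger0_norm ?invr_ge0 ?(ltW c0)// => H1 H2.
have : 3^-1 ^+ n / 2 <= c^-1 * (3^-1 ^+ n / n.+1%:R * M).
  by rewrite (le_trans H1)// ler_wpM2l// invr_ge0 ltW.
rewrite ler_pdivlMl// (_ : 3^-1 ^+ n / n.+1%:R * M = 3^-1 ^+ n * (M / n.+1%:R));
  last by rewrite mulrAC -mulrA.
move=> H3.
have MN : M / n.+1%:R < c / 2.
  have := truncnS_gt (2 * M / c); rewrite -/n ltr_pdivrMr// => H4.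
  by rewrite ltr_pdivrMr// mulrAC ltr_pdivlMr//; lra.
have := ltr_pM2l (third_gt0 n) (M / n.+1%:R) (c / 2); rewrite MN.
by move: H3; set p := 3^-1 ^+ n; set q := M / _; lra.
Qed.

End exact_control.

(** * Thickness *)

Section thickness.
Context {R : realType} {d : nat}.
Notation Rd := (euclidean R d).
Notation leb := (lebesgue R d).
Local Open Scope complex_scope.
Notation norm := (hnorm (dot := @L2dot _ _ _ leb)).

(** The half-side is n + 1 rather than n, so that the volume is positive already for n = 0. *)
Definition centered_cube (n : nat) : set Rd :=
  cube ([tuple (- n.+1%:R)%R | i < d] : Rd) (n.+1%:R *+ 2).

Lemma centered_cubeP n (x : Rd) :
  centered_cube n x <-> forall i, `|coord x i| <= n.+1%:R.
Proof.
by split=> H i; have := H i; rewrite ler_norml /coord tnth_mktuple mulr2n addrA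
  addNr add0r.
Qed.

Lemma not_thick_ex (omega : set Rd) (n : nat) (b : R) :
  measurable omega -> ~ thick omega -> 0 < b ->
  exists x : Rd, (leb ((translate x @^-1` omega) `&` centered_cube n) <= b%:E)%E.
Proof.
move=> mo nthick b0.
pose V : R := (n.+1%:R *+ 2) ^+ d.
have V0 : 0 < V by rewrite exprn_gt0// mulrn_wgt0.
have cubeV : leb (centered_cube n) = V%:E by rewrite lebesgue_cube.
apply: contrapT => /forallNP H; apply: nthick; split => //.
(* If every translate of the cube met [omega] in measure above [b], this cube would witness
   thickness: gamma V <= b, and the minimum enforces gamma <= 1. *)
exists ([tuple (- n.+1%:R)%R | i < d] : Rd), (n.+1%:R *+ 2), (Num.min 1 (b / V)).
split.
- by rewrite lt_min ltr01 divr_gt0.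
- by rewrite ge_min lexx.
move=> x; rewrite -/(centered_cube n) cubeV -EFinM lte_fin; split; last first.
  by rewrite mulr_gt0// lt_min ltr01 divr_gt0.
have /negP := H x; rewrite -ltNge => /ltW.
rewrite (_ : _ `&` centered_cube n =
  translate x @^-1` ((translate^~ x @` centered_cube n) `&` omega)); last first.
  apply/seteqP; split => y /=.
    by move=> [oy Ky]; split => //; exists y => //; rewrite translateC.
  move=> [[z Kz zy] oy]; split => //.
  by move: zy; rewrite translateC => /(can_inj (translateK x)) <-.
rewrite lebesgue_translate; apply: le_trans; rewrite lee_fin.
by rewrite -ler_pdivlMr// ge_min lexx orbT.
Qed.

Lemma commuting_function_ex (s : R) (U : R -> (Rd -> R[i]) -> (Rd -> R[i])) :
  is_exp_group (frac_laplacian s) U ->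
  exists g, [/\ L2 leb setT g, 0 < fdot leb g g &
    forall (a : Rd) t,
      {ae leb, forall x, U t (g \o translate a) x = U t g (translate a x)}].
Proof.
move=> [HU AU].
have mC := measurable_cube ([tuple 0%R | i < d] : Rd) (1 : R).
(* A concrete nonzero vector whose orbit is averaged; it need not lie in the domain of the
   fractional Laplacian. *)
pose one : Rd -> R[i] := \1_(cube ([tuple 0%R | i < d] : Rd) (1 : R)).
have sqr_one x : cmod (one x) ^+ 2 = \1_(cube ([tuple 0%R | i < d] : Rd) (1 : R)) x.
  rewrite /one !indicE; case: (_ \in _); last by rewrite cmod0 expr0n.
  by rewrite cmod_sqr/= expr1n expr0n addr0.
have int_one : (\int[leb]_x (cmod (one x) ^+ 2)%:E = 1)%E.
  under eq_integral do rewrite sqr_one.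
  rewrite integral_indic// setIT; apply: etrans (lebesgue_cube _ ler01) _.
  by rewrite expr1n.
have Lone : L2 leb setT one.
  by apply/L2P; split; [exact: cmeasurable_indic|rewrite int_one ltry].
apply: (@commuting_orbit_ex _ _ _ leb U HU Rd translate (frac_laplacian s)
  (L2class leb one)).
- exact: measurable_translate.
- by move=> a B _; exact: lebesgue_translate.
- by move=> a f g; exact: (@fourier_multiplier_shift _ _ a).
- exact: AU.
apply/eqP => one0; have := fdot_sqrE Lone; rewrite int_one.
rewrite -(L2dotE Lone Lone) one0 (dot0l (L2dotP leb)) => /eqP.
by rewrite eqe oner_eq0.
Qed.

Lemma centered_cube_nd n m : (n <= m)%N -> centered_cube n `<=` centered_cube m.
Proof.
move=> nm x /centered_cubeP xn; apply/centered_cubeP => i.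
by rewrite (le_trans (xn i))// ler_nat.
Qed.

Lemma centered_cube_cover (x : Rd) : exists n, centered_cube n x.
Proof.
exists (\max_(i < d) Num.truncn `|coord x i|); apply/centered_cubeP => i.
rewrite (le_trans (ltW (truncnS_gt _)))// ler_nat ltnS.
exact: (leq_bigmax i).
Qed.

(** Take G(y) = g(y - x). Its orbit is the translated orbit of [g], so observing G on omega amounts
    to observing [g] on omega - x, and [x] is chosen so that omega - x hardly meets the cube on
    which the orbit of [g] concentrates. *)
Lemma unobservable_orbit_ex (U : R -> (Rd -> R[i]) -> (Rd -> R[i]))
    (omega : set Rd) g (S e : R) :
  L2_unitary_group leb U -> measurable omega -> ~ thick omega ->
  L2 leb setT g ->
  (forall (a : Rd) t,
    {ae leb, forall x, U t (g \o translate a) x = U t g (translate a x)}) ->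
  0 < e ->
  exists G, [/\ L2 leb setT G, norm (L2class leb G) = norm (L2class leb g) &
    forall t, `|t| <= S -> norm (L2class leb (fun x => \1_omega x * U t G x)) <= e].
Proof.
move=> HU mo nthick Lg Ug e0.
have mK n : measurable (centered_cube n) by exact: measurable_cube.
have [n [b b0 conc]] :=
  orbit_concentrated HU mK centered_cube_nd centered_cube_cover S Lg e0.
have [x Ex] := not_thick_ex n mo nthick b0.
have mphi := measurable_translate (negv x).
have phi_mu B (_ : measurable B) : leb (translate (negv x) @^-1` B) = leb B.
  exact: lebesgue_translate.
have mE : measurable (translate x @^-1` omega).
  by rewrite -[X in measurable X]setTI; exact: (measurable_translate x).
have LG := L2_comp mphi phi_mu Lg.
exists (g \o translate (negv x)); split => //.
  by rewrite -(L2comp_class mphi phi_mu Lg) (L2comp_norm mphi phi_mu).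
move=> t tS; have LUg := unitary_L2 HU t Lg; have LUG := unitary_L2 HU t LG.
have LE := L2_indic mE LUg.
have -> : L2class leb (fun y => \1_omega y * U t (g \o translate (negv x)) y) =
    L2comp (translate (negv x))
      (L2class leb (fun y => \1_(translate x @^-1` omega) y * U t g y)).
  rewrite (L2comp_class mphi phi_mu LE).
  apply: (eq_L2class (L2_indic mo LUG) (L2_comp mphi phi_mu LE)).
  apply: filterS (Ug (negv x) t) => y ->; rewrite /= !indicE.
  congr (_%:R * _); congr nat_of_bool; apply/idP/idP; rewrite !inE /=.
    by rewrite translateNK.
  by rewrite translateNK.
rewrite (L2comp_norm mphi phi_mu).
exact: conc.
Qed.

End thickness.

(** * Exact controllability forces thickness *)

Theorem theorem2p6 (R : realType) (d : nat) (s T : R)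
    (omega : set (euclidean R d)) :
  (1 <= d)%N -> 0 < s -> 0 < T -> measurable omega ->
  exactly_controllable (frac_laplacian s) omega T ->
  thick omega.
Proof.
move=> _ _ T0 mo [U expU control]; apply: contrapT => nthick.
have [g [Lg g0 Ug]] := commuting_function_ex expU.
have HU : L2_unitary_group (lebesgue R d) U by case: expU.
pose e (n : nat) : R := 3^-1 ^+ n / n.+1%:R.
have e0 n : 0 < e n by rewrite divr_gt0// exprn_gt0// invr_gt0.
have /choice[G GP] (n : nat) := unobservable_orbit_ex T HU mo nthick Lg Ug (e0 n).
have c0 : 0 < hnorm (dot := @L2dot _ _ _ (lebesgue R d)) (L2class _ g).
  by rewrite hnorm.unlock (L2dotE Lg Lg) sqrtr_gt0.
refine (@gliding_hump_contra _ _ _ (lebesgue R d) U omega T _ G c0 _ _ _ _).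
- by move=> n; case: (GP n).
- by move=> n; case: (GP n).
- by move=> n; case: (GP n).
move=> v Lv.
(* Steering 0 to [v] identifies [v] with the Duhamel integral [w], to which [control_bound]
   applies. *)
have [u [f [Lu _ mild fT]]] := control _ v (L2_cst0 _) Lv.
have [|w [bw fw]] := mild T; first by rewrite lexx ltW.
have [M M0 wM] := control_bound HU mo T0 Lu bw.
(* Linearity holds only almost everywhere; applied to zero data it reads U 0 = U 0 + U 0. *)
have U0 : {ae lebesgue R d, forall x, U T (fun=> 0) x = 0}.
  have [_ _ /(_ T 1 _ _ (L2_cst0 _) (L2_cst0 _)) lin _ _] := HU.
  apply: filterS lin => x.
  rewrite (_ : (fun y => 1 * 0 + 0) = (fun=> 0)); last first.
    by apply/funext => y; rewrite mulr0 addr0.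
  by move=> /eqP; rewrite mul1r -subr_eq subrr => /eqP.
have Lw : L2 (lebesgue R d) setT w by case: bw.
have vw : {ae lebesgue R d, forall x, v x = w x}.
  near=> x; rewrite -(near fT x)// (near fw x)// (near U0 x)//.
  by rewrite add0r.
have E h : L2 (lebesgue R d) setT h ->
    fdot (lebesgue R d) v h = fdot (lebesgue R d) w h.
  by move=> Lh; exact: (eq_ae_fdot Lv Lw Lh Lh vw (aeW _ (fun=> erefl))).
exists M; first exact: M0.
move=> h k Lh k0 hk; rewrite (E h Lh).
exact: wM.
Unshelve. all: by end_near. Qed.
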